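(* The complex $3$-dimensional flag manifold $Fl=\{(L,V)\,|\,0\in L\subset V\subset\mathbb{C}^3,\ \dim L=1,\ \dim V=2\}$ admits a generalized pseudo-K\''ahler structure.
   Context: On a smooth manifold $M$, the bundle $TM\oplus T^*M$ carries the natural metric $\langle X+\xi,Y+\eta\rangle=\frac12(\xi(Y)+\eta(X))$ and the Courant bracket $[X+\xi,Y+\eta]=[X,Y]+L_X\eta-L_Y\xi-\frac12(d\imath_X\eta-d\imath_Y\xi)$, where $L_X$ denotes the Lie derivative. A generalized complex structure on $M$ is an endomorphism $I$ of $TM\oplus T^*M$ such that $I^2=-Id$, $I$ preserves $\langle\cdot,\cdot\rangle$, and the $+i$-eigensubbundle of $I$ in $(TM\oplus T^*M)\otimes\mathbb{C}$ is involutive with respect to the Courant bracket. A generalized pseudo-K\''ahler structure on $M$ is a pair of commuting generalized complex structures $I_1,I_2$ such that the $\pm1$-eigenspaces $L^{\pm}$ of $G=I_1I_2$ are transversal to $TM$ and the metric $\langle\cdot,\cdot\rangle$ is non-degenerate on $L^{\pm}$. *)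

(* Defs.v *)
From mathcomp Require Import all_boot all_order all_algebra all_fingroup.
From mathcomp Require Import all_classical all_reals all_analysis.
From mathcomp Require Import complex ring.

Set Implicit Arguments.
Unset Strict Implicit.
Unset Printing Implicit Defensive.

Import Order.TTheory GRing.Theory Num.Theory numFieldNormedType.Exports.

Local Open Scope classical_set_scope.
Local Open Scope ring_scope.
Local Open Scope complex_scope.

(* [U] is meant to be open. Requiring Frechet differentiability at every step
   (rather than mere existence of the derivatives [D_v f]) does not change the
   class of C^k maps between finite-dimensional spaces. *)
Fixpoint Ck_on (R : realType) (V W : normedModType R) (k : nat) (U : set V)
    (f : V -> W) : Prop :=
  if k is k'.+1 then
    (forall x, U x -> differentiable f x) /\ (forall v, Ck_on k' U ('D_v f))
  else forall x, U x -> {for x, continuous f}.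

Definition smooth_on (R : realType) (V W : normedModType R) (U : set V)
    (f : V -> W) : Prop :=
  forall k, Ck_on k U f.

(* The coordinate change from the [i]-th to the [j]-th coordinates; it is
   meaningful only where the [i]-th and [j]-th parametrizations overlap. *)
Definition transition (R : realType) (n : nat) (T I : Type)
    (dom : I -> set 'rV[R]_n) (par : I -> 'rV[R]_n -> T) (i j : I)
    (x : 'rV[R]_n) : 'rV[R]_n :=
  xget 0 [set y | dom j y /\ par j y = par i x].

Definition overlap (R : realType) (n : nat) (T I : Type)
    (dom : I -> set 'rV[R]_n) (par : I -> 'rV[R]_n -> T) (i j : I)
    : set 'rV[R]_n :=
  dom i `&` par i @^-1` (par j @` dom j).

(* An [n]-dimensional smooth manifold, given by an atlas of local
   parametrizations [par i : dom i -> T] (the inverses of coordinate charts).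
   The topology of [T] is the one for which the [par i] are open embeddings;
   [par_hausdorff] says that it is Hausdorff, and it is second countable because
   the atlas is countable. *)
Record smooth_manifold (R : realType) (n : nat) := SmoothManifold {
  points :> Type;
  index : countType;
  dom : index -> set 'rV[R]_n;
  par : index -> 'rV[R]_n -> points;
  dom_open : forall i, open (dom i);
  par_inj : forall i x y, dom i x -> dom i y -> par i x = par i y -> x = y;
  par_cover : forall p, exists i, exists2 x, dom i x & par i x = p;
  overlap_open : forall i j, open (overlap dom par i j);
  transition_smooth : forall i j,
    smooth_on (overlap dom par i j) (transition dom par i j);
  par_hausdorff : forall i j x y, dom i x -> dom j y -> par i x <> par j y ->
    exists A B, [/\ nbhs x A, nbhs y B &
      forall a b, A a -> B b -> dom i a -> dom j b -> par i a <> par j b]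
}.
Arguments index {R n} s.
Arguments dom {R n s} i _.
Arguments par {R n s} i _.

(* In a chart, an element [X + xi] of TM (+) T*M is the row vector
   [row_mx X xi] of its coordinates in the basis
   (d/dx_1, ..., d/dx_n, dx_1, ..., dx_n).
   Endomorphisms act on row vectors, hence on the right: the matrix [J] stands
   for [u |-> u *m J], and the composite [I1 I2] has matrix [J2 *m J1]. *)

(* Vectors transform by the Jacobian matrix of the coordinate change, covectors
   by the inverse of its transpose. *)
Definition tt_cocycle (R : realType) (n : nat) (M : smooth_manifold R n)
    (i j : index M) (x : 'rV[R]_n) : 'M[R]_(n + n) :=
  let D := jacobian (transition (@dom R n M) (@par R n M) i j) x in
  block_mx D 0 0 (invmx D)^T.

(* A smooth endomorphism of TM (+) T*M; the values of [mat i] outside of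
   [dom i] are irrelevant. *)
Record tt_endo (R : realType) (n : nat) (M : smooth_manifold R n) := TTEndo {
  mat : index M -> 'rV[R]_n -> 'M[R]_(n + n);
  mat_smooth : forall i, smooth_on (dom i) (mat i);
  mat_compat : forall i j x, overlap (@dom R n M) (@par R n M) i j x ->
    mat i x *m tt_cocycle i j x =
    tt_cocycle i j x *m
      mat j (transition (@dom R n M) (@par R n M) i j x)
}.

Definition tt_pairing (F : fieldType) (n : nat) (u v : 'rV[F]_(n + n)) : F :=
  2^-1 * (\sum_k rsubmx u 0 k * lsubmx v 0 k
          + \sum_k rsubmx v 0 k * lsubmx u 0 k).

Section CourantBracket.
Variables (R : realType) (n : nat).
Implicit Types (f : 'rV[R]_n -> R[i]) (X Y eta : 'rV[R]_n -> 'rV[R[i]]_n).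

Definition cpartial (k : 'I_n) f (x : 'rV[R]_n) : R[i] :=
  'D_(delta_mx 0 k) (fun y => complex.Re (f y)) x
  +i* 'D_(delta_mx 0 k) (fun y => complex.Im (f y)) x.

Definition ext_d f (x : 'rV[R]_n) : 'rV[R[i]]_n := \row_k cpartial k f x.

Definition contract X eta (x : 'rV[R]_n) : R[i] :=
  \sum_k X x 0 k * eta x 0 k.

Definition lie_bracket X Y (x : 'rV[R]_n) : 'rV[R[i]]_n :=
  \row_k \sum_l (X x 0 l * cpartial l (fun y => Y y 0 k) x
                 - Y x 0 l * cpartial l (fun y => X y 0 k) x).

Definition lie_derivative X eta (x : 'rV[R]_n) : 'rV[R[i]]_n :=
  \row_k \sum_l (X x 0 l * cpartial l (fun y => eta y 0 k) x
                 + eta x 0 l * cpartial k (fun y => X y 0 l) x).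

(* Sections of the complexified bundle over an open subset of a chart; the Lie
   bracket, Lie derivative and differential are the usual coordinate formulas,
   extended C-linearly. *)
Definition courant (A B : 'rV[R]_n -> 'rV[R[i]]_(n + n)) (x : 'rV[R]_n) :
    'rV[R[i]]_(n + n) :=
  let X y := lsubmx (A y) in let xi y := rsubmx (A y) in
  let Y y := lsubmx (B y) in let eta y := rsubmx (B y) in
  row_mx (lie_bracket X Y x)
    (lie_derivative X eta x - lie_derivative Y xi x
     - 2^-1 *: (ext_d (contract X eta) x - ext_d (contract Y xi) x)).

Definition csmooth_section (m : nat) (U : set 'rV[R]_n)
    (A : 'rV[R]_n -> 'rV[R[i]]_m) : Prop :=
  smooth_on U (fun x => map_mx (@complex.Re R) (A x)) /\
  smooth_on U (fun x => map_mx (@complex.Im R) (A x)).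

End CourantBracket.

Section GeneralizedComplex.
Variables (R : realType) (n : nat) (M : smooth_manifold R n).
Implicit Types I : tt_endo M.

Definition in_i_eigenbundle I (i : index M) (W : set 'rV[R]_n)
    (A : 'rV[R]_n -> 'rV[R[i]]_(n + n)) : Prop :=
  forall x, W x -> A x *m map_mx (real_complex R) (mat I i x) = 'i%C *: A x.

Definition i_eigenbundle_involutive I : Prop :=
  forall (i : index M) (W : set 'rV[R]_n), open W -> W `<=` dom i ->
  forall A B : 'rV[R]_n -> 'rV[R[i]]_(n + n),
    csmooth_section W A -> csmooth_section W B ->
    in_i_eigenbundle I i W A -> in_i_eigenbundle I i W B ->
    in_i_eigenbundle I i W (courant A B).

Definition generalized_complex I : Prop :=
  [/\ forall i x, dom i x -> mat I i x *m mat I i x = - 1%:M,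
      forall i x, dom i x -> forall u v : 'rV[R]_(n + n),
        tt_pairing (u *m mat I i x) (v *m mat I i x) = tt_pairing u v
    & i_eigenbundle_involutive I].

(* Its row space is the fibre of TM. *)
Definition tangent_mx : 'M[R]_(n, n + n) := row_mx 1%:M 0.

Definition transversal_to_TM (L : 'M[R]_(n + n)) : Prop :=
  row_full (L + tangent_mx)%MS.

Definition nondegenerate_on (L : 'M[R]_(n + n)) : Prop :=
  forall u : 'rV[R]_(n + n), (u <= L)%MS ->
    (forall v : 'rV[R]_(n + n), (v <= L)%MS -> tt_pairing u v = 0) -> u = 0.

Definition generalized_pseudo_kahler I1 I2 : Prop :=
  [/\ generalized_complex I1,
      generalized_complex I2,
      forall i x, dom i x ->
        mat I1 i x *m mat I2 i x = mat I2 i x *m mat I1 i x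
    & forall i x, dom i x ->
        let G := mat I2 i x *m mat I1 i x in
        [/\ transversal_to_TM (eigenspace G 1),
            transversal_to_TM (eigenspace G (-1)),
            nondegenerate_on (eigenspace G 1)
          & nondegenerate_on (eigenspace G (-1))]].

End GeneralizedComplex.

Definition is_flag (R : realType)
    (F : {vspace 'rV[R[i]]_3} * {vspace 'rV[R[i]]_3}) : bool :=
  [&& (F.1 <= F.2)%VS, \dim F.1 == 1 & \dim F.2 == 2].

Definition flag (R : realType) : Type :=
  {F : {vspace 'rV[R[i]]_3} * {vspace 'rV[R[i]]_3} | is_flag F}.

Section FlagParam.
Variable R : realType.
Implicit Types (s : 'S_3) (x : 'rV[R]_(3 + 3)).

(* [x] encodes the point (z_0, z_1, z_2) of C^3 with z_k = x_k + i x_(k+3). *)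
Definition zcoord x (k : 'I_3) : R[i] := lsubmx x 0 k +i* rsubmx x 0 k.

Definition flag_basis s (k : 'I_3) : 'rV[R[i]]_3 := delta_mx 0 (s k).

(* In the basis permuted by [s], the flag with coordinates (z_0, z_1, z_2) is
   the one with line spanned by (1, z_0, z_1) and plane spanned by
   (1, z_0, z_1) and (0, 1, z_2). *)
Definition flag_vec1 s x : 'rV[R[i]]_3 :=
  flag_basis s 0 + zcoord x 0 *: flag_basis s 1 + zcoord x 1 *: flag_basis s 2.

Definition flag_vec2 s x : 'rV[R[i]]_3 :=
  flag_basis s 1 + zcoord x 2 *: flag_basis s 2.

Definition flag_pair s x : {vspace 'rV[R[i]]_3} * {vspace 'rV[R[i]]_3} :=
  (<[flag_vec1 s x]>%VS, (<[flag_vec1 s x]> + <[flag_vec2 s x]>)%VS).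

End FlagParam.

Section SmoothCalculus.
Variables (R : realType) (V : normedModType R).
Implicit Types (U : set V) (k : nat).

Lemma near0_differentiable (W : normedModType R) (h : V -> W) (x : V) :
  (\forall y \near x, h y = 0) -> differentiable h x.
Proof.
move=> h0; have hx : h x = 0 by exact: nbhs_singleton h0.
have h0' : \forall y \near (0 : V), h (y + x) = 0.
  by have := h0; rewrite [X in X -> _](near_shift 0 x) subr0.
have cz : continuous (\0 : V -> W) by move=> y; exact: cvg_cst.
have E : h \o shift x = cst (h x) + (\0 : V -> W) +o_ 0 id.
  apply/eqaddoP => _ /posnumP[e]; near=> y.
  have -> : (h \o shift x - (cst (h x) + \0)) y = 0.
    rewrite /= hx !fctE /= addr0 subr0; near: y; exact: h0'.
  by rewrite normr0 mulr_ge0.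
have dE := @diff_unique _ _ _ h \0 x cz E.
by apply/diff_locallyP; rewrite dE; split.
Unshelve. all: by end_near. Qed.

Lemma Ck_on_eq (W : normedModType R) k U (f g : V -> W) : open U ->
  (forall x, U x -> f x = g x) -> Ck_on k U f -> Ck_on k U g.
Proof.
move=> oU.
have near_U (h1 h2 : V -> W) x : (forall x, U x -> h1 x = h2 x) -> U x ->
    \forall y \near x, h1 y = h2 y.
  by move=> hE Ux; apply: filterS (open_nbhs_nbhs (conj oU Ux)) => y /hE.
elim: k f g => [|k IH] f g fg /=.
  move=> cf x Ux; suff : g y @[y --> x] --> g x by [].
  rewrite -(fg x Ux).
  apply: cvg_trans (cf x Ux); apply: near_eq_cvg.
  by apply: near_U Ux => y /fg.
move=> [df Cf]; split=> [x Ux|v].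
  have -> : g = f + (g - f) by rewrite addrC subrK.
  apply: differentiableD; first exact: df.
  apply: near0_differentiable; apply: filterS (near_U _ _ _ fg Ux) => y E.
  by rewrite !fctE E subrr.
by apply: IH (Cf v) => x Ux; apply: near_eq_derive; exact: near_U.
Qed.

Lemma Ck_onW (W : normedModType R) k U (f : V -> W) :
  Ck_on k.+1 U f -> Ck_on k U f.
Proof.
elim: k f => [|k IH] f [df Cf]; first by move=> x /df /differentiable_continuous.
by split=> // v; apply: IH.
Qed.

Lemma smooth_on_eq (W : normedModType R) U (f g : V -> W) : open U ->
  (forall x, U x -> f x = g x) -> smooth_on U f -> smooth_on U g.
Proof. by move=> oU fg sf k; apply: Ck_on_eq fg (sf k). Qed.

Lemma smooth_on_cst (W : normedModType R) U (c : W) : smooth_on U (cst c).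
Proof.
move=> k; elim: k c => [|k IH] c /=; first by move=> x _; exact: cvg_cst.
split=> [x _|v]; first exact: differentiable_cst.
have -> : 'D_v (cst c) = cst 0 :> (V -> W).
  by apply/funext => x; rewrite derive_cst.
exact: IH.
Qed.

Lemma Ck_onD (W : normedModType R) k U (f g : V -> W) : open U ->
  Ck_on k U f -> Ck_on k U g -> Ck_on k U (f + g).
Proof.
move=> oU; elim: k f g => [|k IH] f g /=.
  by move=> cf cg x Ux; apply: cvgD; [exact: cf|exact: cg].
move=> [df Cf] [dg Cg]; split=> [x Ux|v].
  by apply: differentiableD; [exact: df|exact: dg].
apply: (@Ck_on_eq _ _ _ ('D_v f + 'D_v g)) => //; last exact: IH.
move=> x Ux; rewrite deriveD //; apply: diff_derivable; [exact: df|exact: dg].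
Qed.

Lemma Ck_onM k U (f g : V -> R) : open U ->
  Ck_on k U f -> Ck_on k U g -> Ck_on k U (f * g).
Proof.
move=> oU; elim: k f g => [|k IH] f g.
  by move=> cf cg x Ux; apply: cvgM; [exact: cf|exact: cg].
move=> Cf Cg; have [Cf' Cg'] := (Ck_onW Cf, Ck_onW Cg).
case: Cf Cg => [df Cf] [dg Cg]; split=> [x Ux|v].
  by apply: differentiableM; [exact: df|exact: dg].
apply: (@Ck_on_eq _ _ _ (f * 'D_v g + g * 'D_v f)) => //.
  move=> x Ux; rewrite deriveM //; apply: diff_derivable; [exact: df|exact: dg].
by apply: Ck_onD => //; apply: IH => //; [exact: Cg|exact: Cf].
Qed.

Lemma Ck_onN (W : normedModType R) k U (f : V -> W) : open U ->
  Ck_on k U f -> Ck_on k U (- f).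
Proof.
move=> oU; elim: k f => [|k IH] f /=.
  by move=> cf x Ux; apply: cvgN; exact: cf.
move=> [df Cf]; split=> [x Ux|v].
  by apply: differentiableN; exact: df.
apply: (@Ck_on_eq _ _ _ (- 'D_v f)) => //; last by apply: IH; exact: Cf.
by move=> x Ux; rewrite deriveN //; apply: diff_derivable; exact: df.
Qed.

Lemma Ck_onV k U (f : V -> R) : open U -> (forall x, U x -> f x != 0) ->
  Ck_on k U f -> Ck_on k U (fun x => (f x)^-1).
Proof.
move=> oU f0; elim: k => [|k IH].
  by move=> cf x Ux; apply: cvgV; [exact: f0|exact: cf].
move=> Cf; have /IH CV := Ck_onW Cf; case: Cf => [df Cf]; split=> [x Ux|v].
  by apply: differentiableV; [exact: df|exact: f0].
apply: (@Ck_on_eq _ _ _ (- ((fun x => (f x)^-1) * (fun x => (f x)^-1) * 'D_v f))) => //.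
  move=> x Ux; rewrite deriveV; [|exact: f0|by apply: diff_derivable; exact: df].
  by rewrite !fctE -expr2 exprVn -mulNr.
apply: Ck_onN => //; apply: Ck_onM; [by []| |exact: Cf].
exact: Ck_onM.
Qed.

Lemma Ck_onZl (W : normedModType R) k U (f : V -> R) (w : W) : open U ->
  Ck_on k U f -> Ck_on k U (fun x => f x *: w).
Proof.
move=> oU; elim: k f => [|k IH] f /=.
  by move=> cf x Ux; apply: cvgZr_tmp; exact: cf.
move=> [df Cf]; split=> [x Ux|v].
  by apply: differentiableZl; exact: df.
apply: (@Ck_on_eq _ _ _ (fun x => 'D_v f x *: w)) => //; last by apply: IH; exact: Cf.
move=> x Ux; have dfx := df x Ux.
rewrite [RHS]deriveE; last exact: differentiableZl.
by rewrite diffZl // deriveE.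
Qed.

End SmoothCalculus.

Lemma smooth_on_mx (R : realType) (V : normedModType R) (m n : nat) (U : set V)
    (f : V -> 'M[R]_(m, n)) : open U ->
  (forall i j, smooth_on U (fun x => f x i j)) -> smooth_on U f.
Proof.
move=> oU sf k.
have -> : f = \sum_i \sum_j (fun x => f x i j *: delta_mx i j).
  apply/funext => x; rewrite fct_sumE [LHS]matrix_sum_delta; apply: eq_bigr => i _.
  by rewrite fct_sumE.
elim/big_ind : _ => [|? ? ? ?|i _]; [exact: smooth_on_cst|exact: Ck_onD|].
elim/big_ind : _ => [|? ? ? ?|j _]; [exact: smooth_on_cst|exact: Ck_onD|].
by apply: Ck_onZl => //; exact: sf.
Qed.

Lemma smooth_on_coord (R : realType) (m n : nat) (U : set 'M[R]_(m, n)) i j :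
  smooth_on U (fun A => A i j).
Proof.
case=> [|k]; first by move=> x _; exact: coord_continuous.
split=> [x _|v]; first exact: differentiable_coord.
suff -> : 'D_v (fun A : 'M[R]_(m, n) => A i j) = cst (v i j).
  exact: smooth_on_cst.
apply/funext => A.
have -> : 'D_v (fun A : 'M[R]_(m, n) => A i j) A = ('D_v id A) i j.
  by rewrite derive_mx ?mxE //; exact: derivable_id.
by rewrite derive_id.
Qed.

Lemma transition_eq (R : realType) (n : nat) (T I : Type)
    (dom : I -> set 'rV[R]_n) (par : I -> 'rV[R]_n -> T) i j x y :
  (forall y1 y2, dom j y1 -> dom j y2 -> par j y1 = par j y2 -> y1 = y2) ->
  dom j y -> par j y = par i x -> transition dom par i j x = y.
Proof.
move=> inj dy E; rewrite /transition.
case: xgetP => [z _ [dz zE]|/(_ y)[]//].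
by apply: inj => //; rewrite zE E.
Qed.

Section ComplexSmooth.
Variable R : realType.
Local Notation C := R[i].

Definition csmooth (V : normedModType R) (U : set V) (f : V -> C) : Prop :=
  smooth_on U (fun p => complex.Re (f p)) /\
  smooth_on U (fun p => complex.Im (f p)).

Section CSmooth.
Variables (V : normedModType R) (U : set V).
Hypothesis oU : open U.
Implicit Types (f g : V -> C) (x : V).

Lemma csmooth_eq f g : (forall x, f x = g x) -> csmooth U f -> csmooth U g.
Proof. by move=> /funext ->. Qed.

Lemma csmooth_cst (c : C) : csmooth U (fun=> c).
Proof. by split; exact: smooth_on_cst. Qed.

Lemma csmoothD f g : csmooth U f -> csmooth U g ->
  csmooth U (fun x => f x + g x).
Proof.
move=> [f1 f2] [g1 g2]; split=> k.
  apply: Ck_on_eq oU _ (Ck_onD oU (f1 k) (g1 k)) => x _.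
  by rewrite !fctE; case: (f x); case: (g x).
apply: Ck_on_eq oU _ (Ck_onD oU (f2 k) (g2 k)) => x _.
by rewrite !fctE; case: (f x); case: (g x).
Qed.

Lemma csmoothM f g : csmooth U f -> csmooth U g ->
  csmooth U (fun x => f x * g x).
Proof.
move=> [f1 f2] [g1 g2]; split=> k.
  apply: Ck_on_eq oU _ (Ck_onD oU (Ck_onM oU (f1 k) (g1 k))
    (Ck_onN oU (Ck_onM oU (f2 k) (g2 k)))) => x _.
  by rewrite !fctE; case: (f x); case: (g x).
apply: Ck_on_eq oU _ (Ck_onD oU (Ck_onM oU (f1 k) (g2 k))
  (Ck_onM oU (f2 k) (g1 k))) => x _.
by rewrite !fctE; case: (f x); case: (g x).
Qed.

Lemma csmoothB f g : csmooth U f -> csmooth U g ->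
  csmooth U (fun x => f x - g x).
Proof.
move=> sf sg; apply: (@csmooth_eq (fun x => f x + (-1) * g x)).
  by move=> x; rewrite mulN1r.
by apply: csmoothD => //; apply: csmoothM => //; exact: csmooth_cst.
Qed.

Definition nsq (c : C) : R := complex.Re c * complex.Re c + complex.Im c * complex.Im c.

Lemma nsq_eq0 (c : C) : (nsq c == 0) = (c == 0).
Proof.
case: c => a b; rewrite /nsq eq_complex /= -!expr2 paddr_eq0 ?sqr_ge0 //.
by rewrite !expf_eq0.
Qed.

Lemma csmoothV f : (forall x, U x -> f x != 0) -> csmooth U f ->
  csmooth U (fun x => (f x)^-1).
Proof.
move=> f0 [f1 f2].
have sV k : Ck_on k U (fun x => (nsq (f x))^-1).
  apply: Ck_onV => // [x /f0|]; first by rewrite nsq_eq0.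
  exact: Ck_onD oU (Ck_onM oU (f1 k) (f1 k)) (Ck_onM oU (f2 k) (f2 k)).
split=> k.
  apply: Ck_on_eq oU _ (Ck_onM oU (f1 k) (sV k)) => x _.
  by rewrite !fctE /nsq; case: (f x).
apply: Ck_on_eq oU _ (Ck_onN oU (Ck_onM oU (f2 k) (sV k))) => x _.
by rewrite !fctE /nsq; case: (f x).
Qed.

Lemma csmooth_div f g : (forall x, U x -> g x != 0) -> csmooth U f ->
  csmooth U g -> csmooth U (fun x => f x / g x).
Proof. by move=> g0 sf sg; apply: csmoothM => //; exact: csmoothV. Qed.

End CSmooth.

Lemma open_nsq_neq0 (V : normedModType R) (f : V -> C) :
  continuous (fun p => complex.Re (f p)) ->
  continuous (fun p => complex.Im (f p)) -> open [set p | f p != 0].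
Proof.
move=> f1 f2.
have -> : [set p | f p != 0] = (fun p => nsq (f p)) @^-1` [set r | r != 0].
  by apply/seteqP; split=> p /=; rewrite nsq_eq0.
apply: open_comp; last exact: open_neq.
by move=> p _; apply: cvgD; apply: cvgM; do ?[exact: f1|exact: f2].
Qed.

Lemma csmooth_open (V : normedModType R) (f : V -> C) :
  csmooth setT f -> open [set p | f p != 0].
Proof.
by move=> [f1 f2]; apply: open_nsq_neq0 => p; [exact: (f1 0%N p I)|exact: (f2 0%N p I)].
Qed.

Section CContinuous.
Variable V : normedModType R.
Implicit Types (f g : V -> C) (x : V).

Definition ccont f := continuous (fun x => complex.Re (f x)) /\
  continuous (fun x => complex.Im (f x)).

Lemma ccont_eq f g : (forall x, f x = g x) -> ccont f -> ccont g.
Proof. by move=> /funext ->. Qed.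

Lemma ccont_cst (c : C) : ccont (fun=> c).
Proof. by split=> x; exact: cvg_cst. Qed.

Lemma ccontD f g : ccont f -> ccont g -> ccont (fun x => f x + g x).
Proof.
move=> [f1 f2] [g1 g2]; split.
  rewrite [F in continuous F](_ : _ = (fun x => complex.Re (f x)) + fun x => complex.Re (g x)).
    by move=> x; apply: cvgD; [exact: f1|exact: g1].
  by apply/funext => x; rewrite !fctE; case: (f x); case: (g x).
rewrite [F in continuous F](_ : _ = (fun x => complex.Im (f x)) + fun x => complex.Im (g x)).
  by move=> x; apply: cvgD; [exact: f2|exact: g2].
by apply/funext => x; rewrite !fctE; case: (f x); case: (g x).
Qed.

Lemma ccontM f g : ccont f -> ccont g -> ccont (fun x => f x * g x).
Proof.
move=> [f1 f2] [g1 g2]; split.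
  rewrite [F in continuous F](_ : _ =
      (fun x => complex.Re (f x)) * (fun x => complex.Re (g x))
      - (fun x => complex.Im (f x)) * (fun x => complex.Im (g x))).
    by move=> x; apply: cvgB; apply: cvgM; [exact: f1|exact: g1|exact: f2|exact: g2].
  by apply/funext => x; rewrite !fctE; case: (f x); case: (g x).
rewrite [F in continuous F](_ : _ =
    (fun x => complex.Re (f x)) * (fun x => complex.Im (g x))
    + (fun x => complex.Im (f x)) * (fun x => complex.Re (g x))).
  by move=> x; apply: cvgD; apply: cvgM; [exact: f1|exact: g2|exact: f2|exact: g1].
by apply/funext => x; rewrite !fctE; case: (f x); case: (g x).
Qed.

Lemma ccontB f g : ccont f -> ccont g -> ccont (fun x => f x - g x).
Proof.
move=> sf sg; apply: (@ccont_eq (fun x => f x + (-1) * g x)).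
  by move=> x; rewrite mulN1r.
by apply: ccontD => //; apply: ccontM => //; exact: ccont_cst.
Qed.

End CContinuous.

Lemma csmooth_ccont (V W : normedModType R) (f : V -> C) (h : W -> V) :
  csmooth setT f -> continuous h -> ccont (fun p => f (h p)).
Proof.
move=> [f1 f2] ch; split=> p.
  apply: (@continuous_comp _ _ _ h (fun q => complex.Re (f q))); first exact: ch.
  exact: (f1 0%N _ I).
apply: (@continuous_comp _ _ _ h (fun q => complex.Im (f q))); first exact: ch.
exact: (f2 0%N _ I).
Qed.

End ComplexSmooth.

Section FlagAtlas.
Variable R : realType.
Local Notation C := R[i].
Implicit Types (s t : 'S_3) (x y : 'rV[R]_(3 + 3)) (u : 'rV[C]_3).

Lemma ord3P (P : 'I_3 -> Prop) : P 0 -> P 1 -> P 2 -> forall k, P k.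
Proof.
move=> P0 P1 P2 [[|[|[|//]]] ltk]; [move: P0|move: P1|move: P2];
  by congr P; apply: val_inj.
Qed.

Lemma flag_basisE s i j : flag_basis R s i 0 (s j) = (j == i)%:R.
Proof. by rewrite mxE (inj_eq perm_inj). Qed.

Lemma flag_basis_sum t u :
  u = u 0 (t 0) *: flag_basis R t 0 + u 0 (t 1) *: flag_basis R t 1
      + u 0 (t 2) *: flag_basis R t 2.
Proof.
apply/rowP => j; rewrite -(permKV t j); move: (_ j); apply: ord3P;
  by rewrite !mxE !(inj_eq perm_inj) /= !(mulr1, mulr0, addr0, add0r).
Qed.

Lemma flag_vec1E s x : [/\ flag_vec1 s x 0 (s 0) = 1,
  flag_vec1 s x 0 (s 1) = zcoord x 0 & flag_vec1 s x 0 (s 2) = zcoord x 1].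
Proof.
by split; rewrite /flag_vec1 !mxE !(inj_eq perm_inj) /=
  ?(mulr1, mulr0, addr0, add0r).
Qed.

Lemma flag_vec2E s x : [/\ flag_vec2 s x 0 (s 0) = 0,
  flag_vec2 s x 0 (s 1) = 1 & flag_vec2 s x 0 (s 2) = zcoord x 2].
Proof.
by split; rewrite /flag_vec2 !mxE !(inj_eq perm_inj) /=
  ?(mulr1, mulr0, addr0, add0r).
Qed.

Lemma flag_vec1_def s x : flag_vec1 s x = flag_basis R s 0
  + zcoord x 0 *: flag_basis R s 1 + zcoord x 1 *: flag_basis R s 2.
Proof. by []. Qed.

Lemma flag_vec2_def s x :
  flag_vec2 s x = flag_basis R s 1 + zcoord x 2 *: flag_basis R s 2.
Proof. by []. Qed.

Lemma zcoord_def x k : zcoord x k = lsubmx x 0 k +i* rsubmx x 0 k.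
Proof. by []. Qed.

Definition in_line t y u : Prop :=
  u 0 (t 1) = u 0 (t 0) * zcoord y 0 /\ u 0 (t 2) = u 0 (t 0) * zcoord y 1.

Definition in_plane t y u : Prop :=
  u 0 (t 2) - u 0 (t 0) * zcoord y 1
    = (u 0 (t 1) - u 0 (t 0) * zcoord y 0) * zcoord y 2.

Lemma flag_lineP t y u : u \in (flag_pair t y).1 <-> in_line t y u.
Proof.
have [e0 e1 e2] := flag_vec1E t y; split=> [/vlineP[c ->]|[E1 E2]].
  move: (flag_vec1 t y) e0 e1 e2 => v e0 e1 e2.
  by rewrite /in_line !mxE e0 e1 e2 mulr1.
apply/vlineP; exists (u 0 (t 0)).
by rewrite [LHS](flag_basis_sum t) E1 E2 flag_vec1_def !scalerDr !scalerA.
Qed.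

Lemma flag_planeP t y u : u \in (flag_pair t y).2 <-> in_plane t y u.
Proof.
have [e0 e1 e2] := flag_vec1E t y; have [f0 f1 f2] := flag_vec2E t y; split.
  case/memv_addP => _ /vlineP[c ->] [_ /vlineP[d ->] ->].
  move: (flag_vec1 t y) (flag_vec2 t y) e0 e1 e2 f0 f1 f2 => v w *.
  rewrite /in_plane !mxE; do ![match goal with H : _ = _ |- _ => rewrite H end].
  by ring.
rewrite /in_plane => E; apply/memv_addP.
exists (u 0 (t 0) *: flag_vec1 t y); first exact: memvZ (memv_line _).
exists ((u 0 (t 1) - u 0 (t 0) * zcoord y 0) *: flag_vec2 t y).
  exact: memvZ (memv_line _).
rewrite [LHS](flag_basis_sum t) flag_vec1_def flag_vec2_def !scalerDr !scalerA -E.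
move: (flag_basis R t 0) (flag_basis R t 1) (flag_basis R t 2) => v0 v1 v2.
by rewrite !scalerBl !addrA; apply/rowP => j; rewrite !mxE; ring.
Qed.

Lemma flag_vec1_neq0 s x : flag_vec1 s x != 0.
Proof.
have [e _ _] := flag_vec1E s x; apply/eqP => E; move: e.
by rewrite E mxE => /eqP; rewrite eq_sym oner_eq0.
Qed.

Lemma flag_vec2_notin s x : flag_vec2 s x \notin <[flag_vec1 s x]>%VS.
Proof.
apply/negP => /(flag_lineP s x)[]; have [-> -> _] := flag_vec2E s x.
by rewrite mul0r => /eqP; rewrite oner_eq0.
Qed.

Lemma dimv_add_line (v w : 'rV[C]_3) : v != 0 -> w \notin <[v]>%VS ->
  \dim (<[v]> + <[w]>)%VS = 2.
Proof.
move=> v0 wv; have w0 : w != 0 by apply: contra wv => /eqP ->; exact: mem0v.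
have dx : (<[v]> :&: <[w]> = 0)%VS.
  apply/eqP; rewrite -subv0; apply/subvP => z; rewrite memv_cap.
  case/andP=> zv /vlineP[c zE]; rewrite memv0 zE.
  have [->|c0] := eqVneq c 0; first by rewrite scale0r.
  case/negP: wv; suff -> : w = c^-1 *: z by apply: memvZ.
  by rewrite zE scalerA mulVf // scale1r.
by rewrite dimv_disjoint_sum // !dim_vline v0 w0.
Qed.

Lemma flag_pair_is_flag s x : is_flag (flag_pair s x).
Proof.
rewrite /is_flag /flag_pair /= addvSl dim_vline flag_vec1_neq0 eqxx /=.
by rewrite dimv_add_line ?flag_vec1_neq0 ?flag_vec2_notin.
Qed.

Definition flag_par s x : flag R := exist _ (flag_pair s x) (flag_pair_is_flag s x).

Lemma vspace_eq_dim (A B : {vspace 'rV[C]_3}) :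
  (A <= B)%VS -> \dim A = \dim B -> A = B.
Proof. by move=> sAB dAB; apply/eqP; rewrite eqEdim sAB dAB leqnn. Qed.

Lemma flag_par_eqP s t x y : flag_par s x = flag_par t y <->
  in_line t y (flag_vec1 s x) /\ in_plane t y (flag_vec2 s x).
Proof.
split=> [/(congr1 val)/= E|[E1 E2]].
  split; [apply/flag_lineP|apply/flag_planeP]; rewrite -E; first exact: memv_line.
  by apply: subvP (memv_line _); exact: addvSr.
have /and3P[_ /eqP d1 /eqP d2] := flag_pair_is_flag s x.
have /and3P[_ /eqP d1' /eqP d2'] := flag_pair_is_flag t y.
have sub1 : ((flag_pair s x).1 <= (flag_pair t y).1)%VS.
  by rewrite -memvE; apply/flag_lineP.
have sub2 : ((flag_pair s x).2 <= (flag_pair t y).2)%VS.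
  rewrite subv_add -!memvE; apply/andP; split; last exact/flag_planeP.
  by apply: subvP (addvSl _ _) _ _; apply/flag_lineP.
have eq1 : (flag_pair s x).1 = (flag_pair t y).1.
  by apply: vspace_eq_dim sub1 _; exact: etrans d1 (esym d1').
have eq2 : (flag_pair s x).2 = (flag_pair t y).2.
  by apply: vspace_eq_dim sub2 _; exact: etrans d2 (esym d2').
by apply: val_inj => /=; move: eq1 eq2; case: flag_pair => ? ?;
  case: flag_pair => ? ? /= -> ->.
Qed.

Lemma zcoord_inj x y : (forall k, zcoord x k = zcoord y k) -> x = y.
Proof.
move=> E; rewrite -(hsubmxK x) -(hsubmxK y).
by congr row_mx; apply/rowP => k; move: (E k); rewrite !zcoord_def => -[].
Qed.

Definition of_zcoord (w : 'I_3 -> C) : 'rV[R]_(3 + 3) :=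
  row_mx (\row_k complex.Re (w k)) (\row_k complex.Im (w k)).

Lemma of_zcoordK (w : 'I_3 -> C) k : zcoord (of_zcoord w) k = w k.
Proof. by rewrite zcoord_def row_mxKl row_mxKr !mxE; case: (w k). Qed.

Lemma flag_par_inj s x y : flag_par s x = flag_par s y -> x = y.
Proof.
move=> /flag_par_eqP; rewrite /in_line /in_plane.
move: (flag_vec1E s x) (flag_vec2E s x).
move: (flag_vec1 s x) (flag_vec2 s x) => v w [-> -> ->] [-> -> ->].
rewrite !mul1r !mul0r !subr0 mul1r => -[[E0 E1] E2].
by apply: zcoord_inj; apply: ord3P.
Qed.

Definition minor s t x : C :=
  flag_vec1 s x 0 (t 0) * flag_vec2 s x 0 (t 1)
  - flag_vec2 s x 0 (t 0) * flag_vec1 s x 0 (t 1).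

Definition new_coord s t x (k : 'I_3) : C :=
  let a j := flag_vec1 s x 0 (t j) in let b j := flag_vec2 s x 0 (t j) in
  if k == 0 then a 1 / a 0 else if k == 1 then a 2 / a 0
  else (a 0 * b 2 - b 0 * a 2) / minor s t x.

Lemma minor_neq0 t (v w : 'rV[C]_3) (z0 z1 z2 : C) :
    v != 0 -> w \notin <[v]>%VS ->
    v 0 (t 1) = v 0 (t 0) * z0 -> v 0 (t 2) = v 0 (t 0) * z1 ->
    w 0 (t 2) - w 0 (t 0) * z1 = (w 0 (t 1) - w 0 (t 0) * z0) * z2 ->
  v 0 (t 0) != 0 /\ v 0 (t 0) * w 0 (t 1) - w 0 (t 0) * v 0 (t 1) != 0.
Proof.
move=> v0 wv E1 E2 E3.
have a0 : v 0 (t 0) != 0.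
  apply: contra v0 => /eqP a0.
  by rewrite (flag_basis_sum t v) E1 E2 a0 !mul0r !scale0r !addr0.
split=> //; apply/eqP; rewrite E1 => m0.
have E4 : w 0 (t 1) = w 0 (t 0) * z0.
  apply/eqP; rewrite -subr_eq0; apply/eqP; apply: (mulfI a0).
  by rewrite mulr0 -[RHS]m0 mulrBr (mulrCA (v 0 (t 0))).
have E5 : w 0 (t 2) = w 0 (t 0) * z1.
  by apply/eqP; rewrite -subr_eq0 E3 E4 subrr mul0r.
case/negP: wv; apply/vlineP; exists (w 0 (t 0) / v 0 (t 0)).
rewrite [LHS](flag_basis_sum t) [X in _ = _ *: X](flag_basis_sum t v).
rewrite E1 E2 E4 E5.
move: (v 0 (t 0)) a0 (w 0 (t 0)) => p p0 q.
move: (flag_basis R t 0) (flag_basis R t 1) (flag_basis R t 2) => u0 u1 u2.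
by apply/rowP => k; rewrite !mxE; field.
Qed.

Lemma flag_overlap_sub s t x y : flag_par s x = flag_par t y ->
  flag_vec1 s x 0 (t 0) != 0 /\ minor s t x != 0.
Proof.
move=> /flag_par_eqP[[E1 E2] E3].
exact: minor_neq0 (flag_vec1_neq0 s x) (flag_vec2_notin s x) E1 E2 E3.
Qed.

Lemma flag_par_new s t x :
  flag_vec1 s x 0 (t 0) != 0 -> minor s t x != 0 ->
  flag_par t (of_zcoord (new_coord s t x)) = flag_par s x.
Proof.
move=> a0 m0; apply/esym/flag_par_eqP; rewrite /in_line /in_plane !of_zcoordK.
rewrite /new_coord /=; move: m0; rewrite /minor.
move: (flag_vec1 s x) (flag_vec2 s x) a0 => a b a0.
move: (a 0 (t 0)) (a 0 (t 1)) (a 0 (t 2))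
  (b 0 (t 0)) (b 0 (t 1)) (b 0 (t 2)) a0.
move=> p q r u v w p0 m0; split; first by split; field.
by field; rewrite p0 m0.
Qed.

Let fdom (s : 'S_3) : set 'rV[R]_(3 + 3) := setT.

Lemma flag_overlapE s t : overlap fdom flag_par s t =
  [set x | flag_vec1 s x 0 (t 0) != 0] `&` [set x | minor s t x != 0].
Proof.
apply/seteqP; split=> [x [_ [y _ E]]|x [a0 m0]].
  exact: flag_overlap_sub (esym E).
by split=> //; exists (of_zcoord (new_coord s t x)); last exact: flag_par_new.
Qed.

Lemma flag_transitionE s t x : overlap fdom flag_par s t x ->
  transition fdom flag_par s t x = of_zcoord (new_coord s t x).
Proof.
rewrite flag_overlapE => -[a0 m0].
have E := flag_par_new a0 m0; move: (of_zcoord _) E => y E.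
apply: (@transition_eq R _ _ _ fdom flag_par s t x y _ I E) => y1 y2 _ _.
exact: flag_par_inj.
Qed.

Lemma perm3_exists (i j : 'I_3) : i != j -> exists s, s 0 = i /\ s 1 = j.
Proof.
move=> ij; exists (tperm 1%R (tperm 0%R i j) * tperm 0%R i)%g.
have k0 : tperm 0 i j != 0.
  by apply: contra ij => /eqP E; rewrite -(tpermK 0 i j) E tpermL.
rewrite !permM tpermL tpermK; split=> //.
have -> : tperm 1 (tperm 0 i j) 0 = 0 by rewrite tpermD.
by rewrite tpermL.
Qed.

Lemma flag_cover (p : flag R) : exists s, exists2 x, fdom s x & flag_par s x = p.
Proof.
case: p => -[L P] /= LP; have /and3P[/= sub dL dP] := LP.
have L0 : L != 0%VS by apply: contraTneq dL => ->; rewrite dimv0.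
pose u := vpick L; have uL : u \in L := memv_pick L.
have u0 : u != 0 by rewrite vpick0.
have EL : L = <[u]>%VS.
  apply/esym/eqP; rewrite eqEdim -memvE uL dim_vline u0.
  by rewrite (eqP dL).
have [i ui] : exists i, u 0 i != 0 by apply/rV0Pn.
have /subvPn[w wP wL] : ~~ (P <= L)%VS.
  by apply/negP => /dimvS; rewrite (eqP dL) (eqP dP).
pose w' := w - (w 0 i / u 0 i) *: u.
have w'P : w' \in P by rewrite memvB // memvZ // (subvP sub).
have w'L : w' \notin L.
  by apply: contra wL => w'L; rewrite -[w](subrK ((w 0 i / u 0 i) *: u)) memvD ?memvZ.
have w'0 : w' != 0 by apply: contra w'L => /eqP ->; exact: mem0v.
have w'i : w' 0 i = 0 by rewrite /w' !mxE mulfVK // subrr.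
have [j wj] : exists j, w' 0 j != 0 by apply/rV0Pn.
have ij : i != j by apply: contraNneq wj => <-; rewrite w'i.
have [s [s0 s1]] := perm3_exists ij.
pose z (k : 'I_3) : C := if k == 0 then u 0 j / u 0 i else
  if k == 1 then u 0 (s 2) / u 0 i else w' 0 (s 2) / w' 0 j.
exists s; exists (of_zcoord z) => //.
have E1 : flag_vec1 s (of_zcoord z) = (u 0 i)^-1 *: u.
  rewrite [X in _ = _ *: X](flag_basis_sum s u) s0 s1 flag_vec1_def !of_zcoordK /z /=.
  by rewrite !scalerDr !scalerA mulVf // scale1r ![_^-1 * _]mulrC.
have E2 : flag_vec2 s (of_zcoord z) = (w' 0 j)^-1 *: w'.
  rewrite [X in _ = _ *: X](flag_basis_sum s w') s0 s1 flag_vec2_def !of_zcoordK /z /=.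
  by rewrite w'i scale0r add0r !scalerDr !scalerA mulVf // scale1r ![_^-1 * _]mulrC.
have sp (c : C) (v : 'rV[C]_3) : c != 0 -> (<[c *: v]> = <[v]>)%VS.
  move=> c0; apply/eqP; rewrite eqEsubv -!memvE memvZ ?memv_line //=.
  by rewrite -{1}[v]scale1r -(mulVf c0) -scalerA memvZ ?memv_line.
apply: val_inj => /=; rewrite /flag_pair E1 E2 !sp ?invr_eq0 // -EL.
congr (_, _); apply/eqP; rewrite eqEdim subv_add sub -memvE w'P (eqP dP).
by rewrite EL dimv_add_line // -EL.
Qed.

Lemma csmooth_zcoord (U : set 'rV[R]_(3 + 3)) k : csmooth U (fun x => zcoord x k).
Proof.
split=> m /=.
  rewrite [F in Ck_on _ _ F](_ : _ = fun x => x 0 (lshift 3 k)).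
    exact: smooth_on_coord.
  by apply/funext => x; rewrite !mxE.
rewrite [F in Ck_on _ _ F](_ : _ = fun x => x 0 (rshift 3 k)).
  exact: smooth_on_coord.
by apply/funext => x; rewrite !mxE.
Qed.

Lemma flag_vec1_coord s x j : flag_vec1 s x 0 j = flag_basis R s 0 0 j +
  zcoord x 0 * flag_basis R s 1 0 j + zcoord x 1 * flag_basis R s 2 0 j.
Proof. by rewrite flag_vec1_def !mxE. Qed.

Lemma flag_vec2_coord s x j : flag_vec2 s x 0 j =
  flag_basis R s 1 0 j + zcoord x 2 * flag_basis R s 2 0 j.
Proof. by rewrite flag_vec2_def !mxE. Qed.

Lemma csmooth_vec1 (U : set 'rV[R]_(3 + 3)) s j : open U ->
  csmooth U (fun x => flag_vec1 s x 0 j).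
Proof.
move=> oU; apply: csmooth_eq => [x|]; first exact/esym/flag_vec1_coord.
apply: csmoothD => //; last first.
  by apply: csmoothM => //; [exact: csmooth_zcoord|exact: csmooth_cst].
apply: csmoothD => //; first exact: csmooth_cst.
by apply: csmoothM => //; [exact: csmooth_zcoord|exact: csmooth_cst].
Qed.

Lemma csmooth_vec2 (U : set 'rV[R]_(3 + 3)) s j : open U ->
  csmooth U (fun x => flag_vec2 s x 0 j).
Proof.
move=> oU; apply: csmooth_eq => [x|]; first exact/esym/flag_vec2_coord.
apply: csmoothD => //; first exact: csmooth_cst.
by apply: csmoothM => //; [exact: csmooth_zcoord|exact: csmooth_cst].
Qed.

Lemma csmooth_minor (U : set 'rV[R]_(3 + 3)) s t : open U ->
  csmooth U (minor s t).
Proof.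
by move=> oU; apply: csmoothB => //; apply: csmoothM => //;
  do ?[exact: csmooth_vec1|exact: csmooth_vec2].
Qed.

Lemma flag_overlap_open s t : open (overlap fdom flag_par s t).
Proof.
rewrite flag_overlapE; apply: openI; apply: csmooth_open.
  by apply: csmooth_vec1; exact: openT.
by apply: csmooth_minor; exact: openT.
Qed.

Lemma flag_transition_smooth s t :
  smooth_on (overlap fdom flag_par s t) (transition fdom flag_par s t).
Proof.
have oU := @flag_overlap_open s t; set U := overlap _ _ _ _ in oU *.
apply: (@smooth_on_eq _ _ _ _ (fun x => of_zcoord (new_coord s t x))) => //.
  by move=> x Ux; rewrite flag_transitionE.
have a0 x : U x -> flag_vec1 s x 0 (t 0) != 0 by rewrite /U flag_overlapE => -[].
have m0 x : U x -> minor s t x != 0 by rewrite /U flag_overlapE => -[].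
have sn : forall k, csmooth U (fun x => new_coord s t x k).
  apply: ord3P; rewrite /new_coord /=; (apply: csmooth_div => //;
    do ?[exact: csmooth_vec1|exact: csmooth_minor]).
  by apply: csmoothB => //; apply: csmoothM => //;
    do ?[exact: csmooth_vec1|exact: csmooth_vec2].
apply: smooth_on_mx => // i j m; rewrite ord1.
have [k ->|k ->] := split_ordP j.
  rewrite [F in Ck_on _ _ F](_ : _ = fun x => complex.Re (new_coord s t x k)).
    exact: (sn k).1.
  by apply/funext => x; rewrite row_mxEl mxE.
rewrite [F in Ck_on _ _ F](_ : _ = fun x => complex.Im (new_coord s t x k)).
  exact: (sn k).2.
by apply/funext => x; rewrite row_mxEr mxE.
Qed.

Lemma ccont_separate (x y : 'rV[R]_(3 + 3))
    (g : 'rV[R]_(3 + 3) * 'rV[R]_(3 + 3) -> C) :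
  ccont g -> g (x, y) != 0 ->
  exists A B, [/\ nbhs x A, nbhs y B & forall a b, A a -> B b -> g (a, b) != 0].
Proof.
move=> [g1 g2] gxy; have := open_nsq_neq0 g1 g2.
move=> og; have : nbhs (x, y) [set p | g p != 0] by apply: open_nbhs_nbhs.
case=> -[A B] /= [nA nB] AB; exists A, B; split=> // a b Aa Bb.
exact: (AB (a, b)).
Qed.

Lemma ccont_separate3 (P : 'rV[R]_(3 + 3) -> 'rV[R]_(3 + 3) -> Prop)
    (g1 g2 g3 : 'rV[R]_(3 + 3) * 'rV[R]_(3 + 3) -> C) x y :
  ccont g1 -> ccont g2 -> ccont g3 ->
  (forall a b, P a b <-> [/\ g1 (a, b) = 0, g2 (a, b) = 0 & g3 (a, b) = 0]) ->
  ~ P x y ->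
  exists A B, [/\ nbhs x A, nbhs y B & forall a b, A a -> B b -> ~ P a b].
Proof.
move=> cg1 cg2 cg3 PE nP.
have sep g : ccont g -> g (x, y) != 0 -> (forall a b, P a b -> g (a, b) = 0) ->
    exists A B, [/\ nbhs x A, nbhs y B & forall a b, A a -> B b -> ~ P a b].
  move=> cg gxy gE; have [A [B [nA nB AB]]] := ccont_separate cg gxy.
  exists A, B; split=> // a b Aa Bb /gE E.
  by move: (AB a b Aa Bb); rewrite E eqxx.
have [e1|n1] := eqVneq (g1 (x, y)) 0; last by apply: sep cg1 n1 _ => a b /PE[].
have [e2|n2] := eqVneq (g2 (x, y)) 0; last by apply: sep cg2 n2 _ => a b /PE[].
have [e3|n3] := eqVneq (g3 (x, y)) 0; last by apply: sep cg3 n3 _ => a b /PE[].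
by case: nP; apply/PE.
Qed.

Lemma subr_eq0_3 (a a' b b' c c' : C) :
  (a = a' /\ b = b') /\ c = c' <-> [/\ a - a' = 0, b - b' = 0 & c - c' = 0].
Proof.
by split=> [[[-> ->] ->]|[/subr0_eq-> /subr0_eq-> /subr0_eq->]//]; rewrite !subrr.
Qed.

Lemma flag_hausdorff s t x y : fdom s x -> fdom t y ->
  flag_par s x <> flag_par t y ->
  exists A B, [/\ nbhs x A, nbhs y B &
    forall a b, A a -> B b -> fdom s a -> fdom t b -> flag_par s a <> flag_par t b].
Proof.
move=> _ _ ne.
have c1 j : ccont (fun p : 'rV[R]_(3 + 3) * 'rV[R]_(3 + 3) => flag_vec1 s p.1 0 j).
  apply: (@csmooth_ccont R _ _ (fun x => flag_vec1 s x 0 j)).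
    by apply: csmooth_vec1; exact: openT.
  by move=> p; exact: cvg_fst.
have c2 j : ccont (fun p : 'rV[R]_(3 + 3) * 'rV[R]_(3 + 3) => flag_vec2 s p.1 0 j).
  apply: (@csmooth_ccont R _ _ (fun x => flag_vec2 s x 0 j)).
    by apply: csmooth_vec2; exact: openT.
  by move=> p; exact: cvg_fst.
have cz j : ccont (fun p : 'rV[R]_(3 + 3) * 'rV[R]_(3 + 3) => zcoord p.2 j).
  apply: (@csmooth_ccont R _ _ (fun x => zcoord x j)).
    exact: csmooth_zcoord.
  by move=> p; exact: cvg_snd.
have cg1 := ccontB (c1 (t 1)) (ccontM (c1 (t 0)) (cz 0)).
have cg2 := ccontB (c1 (t 2)) (ccontM (c1 (t 0)) (cz 1)).
have cg3 := ccontB (ccontB (c2 (t 2)) (ccontM (c2 (t 0)) (cz 1)))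
  (ccontM (ccontB (c2 (t 1)) (ccontM (c2 (t 0)) (cz 0))) (cz 2)).
pose P a b := flag_par s a = flag_par t b.
have PE a b := iff_trans (flag_par_eqP s t a b) (subr_eq0_3 _ _ _ _ _ _).
have [A [B [nA nB AB]]] := @ccont_separate3 P _ _ _ x y cg1 cg2 cg3 PE ne.
exists A, B; split; [exact: nA|exact: nB|move=> a b Aa Bb _ _].
exact: AB Aa Bb.
Qed.

(* The underlying smooth manifold, of real dimension 6, of the complex flag
   manifold; the atlas has one affine cell, parametrized by the whole of C^3, for
   each ordering of the standard basis. *)
Definition flag_manifold : smooth_manifold R (3 + 3) :=
  SmoothManifold (fun _ => openT) (fun s x y _ _ => @flag_par_inj s x y)
    flag_cover (@flag_overlap_open)
    (@flag_transition_smooth) (@flag_hausdorff).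

End FlagAtlas.

(* Main.v *)
Require Import Defs.
From mathcomp Require Import all_boot all_order all_algebra.
From mathcomp Require Import all_classical all_reals all_analysis.
From mathcomp Require Import complex ring perm.

(* The flag manifold is Kaehler: it embeds in P^2 x P^2* by (L, V), and the sum of
   the two Fubini-Study forms, i ddbar log |v|^2 + i ddbar log |v /\ w|^2 for a
   local holomorphic frame v, w of the flag, is a Kaehler form. A Kaehler structure
   with complex structure J, symplectic form W and metric g = W J gives the
   commuting generalized complex structures (X, xi) |-> (J X, - J^* xi) and
   (X, xi) |-> (- W^-1 xi, W X); the eigenspaces of their product are the graphs
   of g and - g, on which the pairing is g and - g. *)

Set Implicit Arguments.
Unset Strict Implicit.
Unset Printing Implicit Defensive.

Import Order.TTheory GRing.Theory Num.Theory numFieldNormedType.Exports.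

Local Open Scope classical_set_scope.
Local Open Scope ring_scope.

(** * Calculus of complex-valued functions *)

Section ComplexParts.
Variable R : realType.
Implicit Types z w : R[i].

Lemma complex_ext z w :
  complex.Re z = complex.Re w -> complex.Im z = complex.Im w -> z = w.
Proof. by case: z w => [a b] [c d] /= -> ->. Qed.

Lemma complex_ReD z w : complex.Re (z + w) = complex.Re z + complex.Re w.
Proof. by case: z w => [a b] [c d]. Qed.

Lemma complex_ImD z w : complex.Im (z + w) = complex.Im z + complex.Im w.
Proof. by case: z w => [a b] [c d]. Qed.

Lemma complex_ReN z : complex.Re (- z) = - complex.Re z.
Proof. by case: z. Qed.

Lemma complex_ImN z : complex.Im (- z) = - complex.Im z.
Proof. by case: z. Qed.

Lemma complex_ReM z w : complex.Re (z * w) =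
  complex.Re z * complex.Re w - complex.Im z * complex.Im w.
Proof. by case: z w => [a b] [c d]. Qed.

Lemma complex_ImM z w : complex.Im (z * w) =
  complex.Re z * complex.Im w + complex.Im z * complex.Re w.
Proof. by case: z w => [a b] [c d]. Qed.

Lemma complex_Re_conj z : complex.Re z^* = complex.Re z.
Proof. by case: z. Qed.

Lemma complex_Im_conj z : complex.Im z^* = - complex.Im z.
Proof. by case: z. Qed.

Lemma complex_Re_sum (I : Type) (r : seq I) (P : pred I) (F : I -> R[i]) :
  complex.Re (\sum_(i <- r | P i) F i) = \sum_(i <- r | P i) complex.Re (F i).
Proof. by apply: (big_morph (@complex.Re R) complex_ReD). Qed.

Lemma complex_Im_sum (I : Type) (r : seq I) (P : pred I) (F : I -> R[i]) :
  complex.Im (\sum_(i <- r | P i) F i) = \sum_(i <- r | P i) complex.Im (F i).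
Proof. by apply: (big_morph (@complex.Im R) complex_ImD). Qed.

End ComplexParts.

Lemma smooth_on_comp_coord (R : realType) (V : normedModType R) (m n : nat)
    (U : set V) (f : V -> 'M[R]_(m, n)) i j : open U ->
  smooth_on U f -> smooth_on U (fun x => f x i j).
Proof.
move=> oU sf k; elim: k f sf => [|k IH] f sf.
  move=> x Ux; apply: (@continuous_comp _ _ _ f (fun A : 'M[R]_(m, n) => A i j)).
    exact: (sf 0%N x Ux).
  exact: coord_continuous.
have df x : U x -> differentiable f x by exact: (sf 1%N).1.
split=> [x Ux|v].
  apply: (@differentiable_comp _ _ _ _ f (fun A : 'M[R]_(m, n) => A i j)).
    exact: df.
  exact: differentiable_coord.
have sD : smooth_on U ('D_v f) by move=> k'; exact: (sf k'.+1).2.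
apply: Ck_on_eq oU _ (IH _ sD) => x Ux.
by rewrite derive_mx ?mxE //; apply: diff_derivable; exact: df.
Qed.

Section ComplexCalculus.
Variables (R : realType) (n : nat).
Local Notation C := R[i].
Local Notation V := 'rV[R]_n.
Implicit Types (f g : V -> C) (U : set V) (k l : 'I_n).

Lemma csmooth_conj U f : open U -> csmooth U f -> csmooth U (fun x => (f x)^* ).
Proof.
move=> oU [f1 f2]; split=> k.
  by apply: Ck_on_eq oU _ (f1 k) => x _; rewrite complex_Re_conj.
by apply: Ck_on_eq oU _ (Ck_onN oU (f2 k)) => x _; rewrite complex_Im_conj.
Qed.

Lemma csmooth_sum U (I : Type) (r : seq I) (P : pred I) (F : I -> V -> C) :
  open U -> (forall i, csmooth U (F i)) ->
  csmooth U (fun x => \sum_(i <- r | P i) F i x).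
Proof.
move=> oU sF; elim: r => [|i r IH].
  by apply: csmooth_eq (csmooth_cst U 0) => x; rewrite big_nil.
have [Pi|nPi] := boolP (P i); last first.
  by apply: csmooth_eq IH => x; rewrite big_cons (negbTE nPi).
by apply: csmooth_eq (csmoothD oU (sF i) IH) => x; rewrite big_cons Pi.
Qed.

Lemma csmooth_real U (f : V -> R) : smooth_on U f -> csmooth U (fun x => (f x)%:C%C).
Proof. by move=> sf; split; [exact: sf|exact: smooth_on_cst]. Qed.

Lemma csmooth_cpartial U f k : csmooth U f -> csmooth U (cpartial k f).
Proof. by move=> [f1 f2]; split=> j; [exact: (f1 j.+1).2|exact: (f2 j.+1).2]. Qed.

Lemma csmooth_derivable U f x v : csmooth U f -> U x ->
  derivable (fun y => complex.Re (f y)) x v /\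
  derivable (fun y => complex.Im (f y)) x v.
Proof.
move=> [f1 f2] Ux; split; apply: diff_derivable; first exact: (f1 1%N).1.
exact: (f2 1%N).1.
Qed.

Lemma eq_cpartial U f g k x : open U -> (forall y, U y -> f y = g y) -> U x ->
  cpartial k f x = cpartial k g x.
Proof.
move=> oU fg Ux; have nU : \forall y \near x, U y by exact: open_nbhs_nbhs.
congr (Complex _ _); apply: near_eq_derive; apply: filterS nU => y /fg -> //.
Qed.

Lemma cpartial_cst k (c : C) x : cpartial k (fun=> c) x = 0.
Proof. by congr (Complex _ _); exact: derive_cst. Qed.

Lemma eq_derive (h1 h2 : V -> R) v x : h1 =1 h2 -> 'D_v h1 x = 'D_v h2 x.
Proof. by move=> /funext ->. Qed.

Lemma cpartialD U f g k x : csmooth U f -> csmooth U g -> U x ->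
  cpartial k (fun y => f y + g y) x = cpartial k f x + cpartial k g x.
Proof.
move=> sf sg Ux.
have [f1 f2] := csmooth_derivable (delta_mx 0 k) sf Ux.
have [g1 g2] := csmooth_derivable (delta_mx 0 k) sg Ux.
apply: complex_ext; rewrite ?(complex_ReD, complex_ImD).
  by apply: etrans (eq_derive _ _ _) (deriveD f1 g1) => y; rewrite complex_ReD.
by apply: etrans (eq_derive _ _ _) (deriveD f2 g2) => y; rewrite complex_ImD.
Qed.

Lemma cpartialM U f g k x : csmooth U f -> csmooth U g -> U x ->
  cpartial k (fun y => f y * g y) x = cpartial k f x * g x + f x * cpartial k g x.
Proof.
move=> sf sg Ux.
have [f1 f2] := csmooth_derivable (delta_mx 0 k) sf Ux.
have [g1 g2] := csmooth_derivable (delta_mx 0 k) sg Ux.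
apply: complex_ext; rewrite ?(complex_ReD, complex_ImD, complex_ReM, complex_ImM).
  apply: etrans (eq_derive _ _ _)
    (etrans (deriveB (derivableM f1 g1) (derivableM f2 g2)) _).
    by move=> y; rewrite complex_ReM.
  rewrite (deriveM f1 g1) (deriveM f2 g2) /cpartial /GRing.scale /=.
  move: ('D_(delta_mx 0 k) (fun y => complex.Re (f y)) x)
    ('D_(delta_mx 0 k) (fun y => complex.Im (f y)) x)
    ('D_(delta_mx 0 k) (fun y => complex.Re (g y)) x)
    ('D_(delta_mx 0 k) (fun y => complex.Im (g y)) x) => a b c d.
  by ring.
apply: etrans (eq_derive _ _ _)
  (etrans (deriveD (derivableM f1 g2) (derivableM f2 g1)) _).
  by move=> y; rewrite complex_ImM.
rewrite (deriveM f1 g2) (deriveM f2 g1) /cpartial /GRing.scale /=.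
move: ('D_(delta_mx 0 k) (fun y => complex.Re (f y)) x)
  ('D_(delta_mx 0 k) (fun y => complex.Im (f y)) x)
  ('D_(delta_mx 0 k) (fun y => complex.Re (g y)) x)
  ('D_(delta_mx 0 k) (fun y => complex.Im (g y)) x) => a b c d.
by ring.
Qed.

Lemma cpartial_conj U f k x : csmooth U f -> U x ->
  cpartial k (fun y => (f y)^* ) x = (cpartial k f x)^*.
Proof.
move=> sf Ux; have [f1 f2] := csmooth_derivable (delta_mx 0 k) sf Ux.
apply: complex_ext; rewrite ?complex_Re_conj ?complex_Im_conj.
  by apply: eq_derive => y; rewrite complex_Re_conj.
by apply: etrans (eq_derive _ _ _) (deriveN f2) => y; rewrite complex_Im_conj.
Qed.

Lemma cpartialZ U f k x (c : C) : open U -> csmooth U f -> U x ->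
  cpartial k (fun y => c * f y) x = c * cpartial k f x.
Proof.
move=> oU sf Ux; rewrite (cpartialM _ (csmooth_cst U c) sf Ux).
by rewrite cpartial_cst mul0r add0r.
Qed.

Lemma cpartialB U f g k x : open U -> csmooth U f -> csmooth U g -> U x ->
  cpartial k (fun y => f y - g y) x = cpartial k f x - cpartial k g x.
Proof.
move=> oU sf sg Ux; have sNg := csmoothM oU (csmooth_cst U (-1)) sg.
have -> : (fun y => f y - g y) = (fun y => f y + (-1) * g y).
  by apply/funext => y; rewrite mulN1r.
by rewrite (cpartialD _ sf sNg Ux) (cpartialZ _ _ oU sg Ux) mulN1r.
Qed.

Lemma cpartial_sum U (I : Type) (r : seq I) (P : pred I) (F : I -> V -> C) k x :
  open U -> (forall i, csmooth U (F i)) -> U x ->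
  cpartial k (fun y => \sum_(i <- r | P i) F i y) x =
  \sum_(i <- r | P i) cpartial k (F i) x.
Proof.
move=> oU sF Ux; elim: r => [|i r IH].
  rewrite big_nil -[RHS](cpartial_cst k 0 x); congr (cpartial k _ x).
  by apply/funext => y; rewrite big_nil.
rewrite big_cons; have [Pi|nPi] := boolP (P i).
  rewrite -IH -(cpartialD _ (sF i) (csmooth_sum r P oU sF) Ux).
  by congr (cpartial k _ x); apply/funext => y; rewrite big_cons Pi.
rewrite -IH; congr (cpartial k _ x).
by apply/funext => y; rewrite big_cons (negbTE nPi).
Qed.

Lemma cpartialV U f k x : open U -> (forall y, U y -> f y != 0) ->
  csmooth U f -> U x ->
  cpartial k (fun y => (f y)^-1) x = - cpartial k f x / f x ^+ 2.
Proof.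
move=> oU f0 sf Ux; have sV := csmoothV oU f0 sf.
have fx0 := f0 _ Ux.
have /eqP := cpartialM k sf sV Ux.
rewrite (@eq_cpartial U _ (fun=> 1)) //; last first.
  by move=> y /f0 ?; rewrite mulfV.
rewrite cpartial_cst eq_sym addrC addr_eq0 => /eqP E.
by apply: (mulfI fx0); rewrite E; field.
Qed.

Lemma cpartial_comp U (phi : V -> V) f k x : open U -> U x ->
  smooth_on U phi -> csmooth setT f ->
  cpartial k (fun y => f (phi y)) x =
  \sum_l (jacobian phi x k l)%:C%C * cpartial l f (phi x).
Proof.
move=> oU Ux sphi [f1 f2]; have dphi := (sphi 1%N).1 _ Ux.
have chain (h : V -> R) : smooth_on setT h -> 'D_(delta_mx 0 k) (h \o phi) x =
    \sum_l jacobian phi x k l * 'D_(delta_mx 0 l) h (phi x).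
  move=> sh; have dh := (sh 1%N).1 (phi x) I.
  rewrite deriveE; last exact: differentiable_comp.
  rewrite diff_comp //=.
  have -> : 'd phi x (delta_mx 0 k) = \sum_l jacobian phi x k l *: delta_mx 0 l.
    rewrite -deriveE // deriveEjacobian // -rowE {1}[row k _]row_sum_delta.
    by apply: eq_bigr => l _; rewrite mxE.
  rewrite linear_sum; apply: eq_bigr => l _.
  by rewrite linearZ /= -deriveE.
apply: complex_ext => /=.
  rewrite complex_Re_sum [LHS](chain (fun y => complex.Re (f y)) f1).
  by apply: eq_bigr => l _; rewrite complex_ReM /= mul0r subr0.
rewrite complex_Im_sum [LHS](chain (fun y => complex.Im (f y)) f2).
by apply: eq_bigr => l _; rewrite complex_ImM /= mul0r addr0.
Qed.

End ComplexCalculus.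

(** * Fubini-Study forms *)

Section FubiniStudyAlgebra.
Variables (C : numClosedFieldType) (J : finType).
Implicit Types u v w : J -> C.

Definition herm u w : C := \sum_j u j * (w j)^*.

(* Up to a factor, the value at [v] of the Hermitian form ddbar log |v|^2 on the
   tangent vectors [w] and [w']. *)
Definition fs_form v w w' : C :=
  herm w w' / herm v v - herm w v * herm v w' / herm v v ^+ 2.

Lemma herm_conj u w : (herm u w)^* = herm w u.
Proof.
by rewrite rmorph_sum; apply: eq_bigr => j _; rewrite rmorphM /= conjCK mulrC.
Qed.

Lemma herm_suml (I : finType) (c : I -> C) (w : I -> J -> C) u :
  herm (fun j => \sum_a c a * w a j) u = \sum_a c a * herm (w a) u.
Proof.
under [RHS]eq_bigr do rewrite mulr_sumr.
rewrite exchange_big; apply: eq_bigr => j _; rewrite mulr_suml.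
by apply: eq_bigr => a _; rewrite mulrA.
Qed.

Lemma hermDZl (c : C) u v w :
  herm (fun j => c * u j + v j) w = c * herm u w + herm v w.
Proof.
by rewrite mulr_sumr -big_split; apply: eq_bigr => j _; rewrite mulrDl mulrA.
Qed.

Lemma hermDZr (c : C) u v w :
  herm w (fun j => c * u j + v j) = c^* * herm w u + herm w v.
Proof. by rewrite -herm_conj hermDZl rmorphD rmorphM /= !herm_conj. Qed.

Lemma hermZl (c : C) u w : herm (fun j => c * u j) w = c * herm u w.
Proof. by rewrite mulr_sumr; apply: eq_bigr => j _; rewrite mulrA. Qed.

Lemma hermZr (c : C) u w : herm u (fun j => c * w j) = c^* * herm u w.
Proof. by rewrite -herm_conj hermZl rmorphM /= herm_conj. Qed.

Lemma herm_ge0 v : 0 <= herm v v.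
Proof. by apply: sumr_ge0 => j _; exact: mul_conjC_ge0. Qed.

Lemma herm_neq0 v j : v j != 0 -> herm v v != 0.
Proof.
move=> vj; rewrite /herm psumr_neq0 => [|i _]; last exact: mul_conjC_ge0.
by apply/hasP; exists j; rewrite ?mem_index_enum // mul_conjC_gt0.
Qed.

Lemma fs_form_conj v w w' : (fs_form v w w')^* = fs_form v w' w.
Proof.
rewrite /fs_form rmorphB !rmorphM /= !fmorphV /= rmorphXn /= !herm_conj.
by rewrite [herm v w * _]mulrC.
Qed.

Lemma fs_form_suml (I : finType) (c : I -> C) (w : I -> J -> C) v w' :
  fs_form v (fun j => \sum_a c a * w a j) w' = \sum_a c a * fs_form v (w a) w'.
Proof.
rewrite /fs_form !herm_suml !mulr_suml -sumrB; apply: eq_bigr => a _.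
by rewrite !mulrBr !mulrA.
Qed.

Lemma fs_form_sumr (I : finType) (c : I -> C) (w : I -> J -> C) v w' :
  fs_form v w' (fun j => \sum_a c a * w a j) =
  \sum_a (c a)^* * fs_form v w' (w a).
Proof.
rewrite -fs_form_conj fs_form_suml rmorph_sum; apply: eq_bigr => a _.
by rewrite rmorphM /= fs_form_conj.
Qed.

Lemma fs_formZl v w w' (c : C) :
  fs_form v (fun j => c * w j) w' = c * fs_form v w w'.
Proof. by rewrite /fs_form !hermZl; ring. Qed.

Lemma fs_formZr v w w' (c : C) :
  fs_form v w (fun j => c * w' j) = c^* * fs_form v w w'.
Proof. by rewrite /fs_form !hermZr; ring. Qed.

(* The form only depends on the line spanned by [v]: rescaling [v] by [c] changes
   a derivative [w] of [v] into [c w + c' v]. *)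
Lemma fs_form_rescale (c d d' : C) v w w' : c != 0 -> herm v v != 0 ->
  fs_form (fun j => c * v j) (fun j => c * w j + d * v j)
    (fun j => c * w' j + d' * v j) = fs_form v w w'.
Proof.
move=> c0 v0; have c0' : c^* != 0 by rewrite conjC_eq0.
rewrite /fs_form !(hermDZl, hermDZr, hermZl, hermZr).
move: (herm v v) (herm v w') (herm w v) (herm w w') c^* (d'^* ) v0 c0'.
by move=> N p q r cc dd N0 cc0; field; rewrite N0 cc0 c0.
Qed.

Lemma lagrange_identity v w :
  \sum_i \sum_j (v i * w j - v j * w i) * (v i * w j - v j * w i)^* =
  2 * (herm v v * herm w w - herm w v * herm v w).
Proof.
have E (a b c d : J -> C) : herm a b * herm c d =
    \sum_i \sum_j a i * (b i)^* * (c j * (d j)^* ).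
  by rewrite mulr_suml; apply: eq_bigr => i _; rewrite mulr_sumr.
rewrite mulrBr mulr_natl mulr2n {2}[herm v v * _]mulrC mulr_natl mulr2n.
rewrite {2}[herm w v * _]mulrC !E -!big_split -sumrB; apply: eq_bigr => i _.
rewrite -!big_split -sumrB; apply: eq_bigr => j _ /=.
by rewrite rmorphB !rmorphM /=; ring.
Qed.

Lemma fs_formE v w : herm v v != 0 -> fs_form v w w =
  (\sum_i \sum_j (v i * w j - v j * w i) * (v i * w j - v j * w i)^* ) /
  (2 * herm v v ^+ 2).
Proof.
rewrite lagrange_identity /fs_form; move: (herm v v) => N N0.
by field.
Qed.

Lemma fs_form_ge0 v w : herm v v != 0 -> 0 <= fs_form v w w.
Proof.
move=> /fs_formE ->; rewrite divr_ge0 ?mulr_ge0 ?ler0n ?exprn_ge0 ?herm_ge0 //.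
by apply: sumr_ge0 => i _; apply: sumr_ge0 => j _; exact: mul_conjC_ge0.
Qed.

Lemma fs_form_eq0 v w : herm v v != 0 -> fs_form v w w = 0 ->
  forall i j, v i * w j = v j * w i.
Proof.
move=> v0; rewrite fs_formE // => /eqP.
rewrite mulf_eq0 invr_eq0 mulf_eq0 pnatr_eq0 expf_eq0 (negbTE v0) /= orbF.
rewrite psumr_eq0 => [/allP E i j|i _]; last first.
  by apply: sumr_ge0 => j _; exact: mul_conjC_ge0.
have := E i (mem_index_enum _).
rewrite psumr_eq0 /= => [/allP/(_ j (mem_index_enum _))|j' _]; last first.
  exact: mul_conjC_ge0.
by rewrite /= mul_conjC_eq0 subr_eq0 => /eqP.
Qed.

(* The derivative in the direction [m] of the coefficient [k, l] of the form, for
   a function with value [v], first derivatives [p] and second derivatives [q]. *)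
Definition fs_form_der (K : Type) v (p : K -> J -> C) (q : K -> K -> J -> C)
    (m k l : K) : C :=
  (herm (q m k) (p l) + herm (p k) (q m l)) / herm v v
  - herm (p k) (p l) * (herm (p m) v + herm v (p m)) / herm v v ^+ 2
  - ((herm (q m k) v + herm (p k) (p m)) * herm v (p l)
     + herm (p k) v * (herm (p m) (p l) + herm v (q m l))) / herm v v ^+ 2
  + herm (p k) v * herm v (p l) * (herm (p m) v + herm v (p m)) * 2
    / herm v v ^+ 3.

Lemma fs_form_der_cyclic (K : Type) v (p : K -> J -> C) (q : K -> K -> J -> C) k l m :
  herm v v != 0 -> (forall a b, q a b = q b a) ->
  (fs_form_der v p q k l m - fs_form_der v p q k m l)
  + (fs_form_der v p q l m k - fs_form_der v p q l k m)
  + (fs_form_der v p q m k l - fs_form_der v p q m l k) = 0.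
Proof.
move=> v0 qC; rewrite /fs_form_der (qC l k) (qC m k) (qC m l).
by move: (herm v v) v0 => N N0; field.
Qed.

End FubiniStudyAlgebra.

Section FubiniStudyForm.
Variables (R : realType) (n : nat) (J : finType).
Local Notation C := R[i].
Local Notation V := 'rV[R]_n.
Implicit Types (f : V -> C) (v : J -> V -> C).

Definition symmetric_hessian f : Prop :=
  forall (k l : 'I_n) x, cpartial k (cpartial l f) x = cpartial l (cpartial k f) x.

Definition fubini_study v (x : V) (k l : 'I_n) : C :=
  fs_form (v^~ x) (fun j => cpartial k (v j) x) (fun j => cpartial l (v j) x).

Section Calculus.
Variable v : J -> V -> C.
Hypothesis sv : forall j, csmooth setT (v j).
Hypothesis v0 : forall x, herm (v^~ x) (v^~ x) != 0.

Let pv k j (x : V) : C := cpartial k (v j) x.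

Let spv k j : csmooth setT (pv k j).
Proof. exact: csmooth_cpartial. Qed.

Lemma csmooth_herm (u w : J -> V -> C) : (forall j, csmooth setT (u j)) ->
  (forall j, csmooth setT (w j)) -> csmooth setT (fun x => herm (u^~ x) (w^~ x)).
Proof.
move=> su sw; apply: csmooth_sum => [|j]; first exact: openT.
by apply: csmoothM => //; [exact: openT|apply: csmooth_conj => //; exact: openT].
Qed.

Lemma cpartial_herm (u w : J -> V -> C) k x : (forall j, csmooth setT (u j)) ->
  (forall j, csmooth setT (w j)) ->
  cpartial k (fun x => herm (u^~ x) (w^~ x)) x =
  herm (fun j => cpartial k (u j) x) (w^~ x) +
  herm (u^~ x) (fun j => cpartial k (w j) x).
Proof.
move=> su sw; have sc j := csmooth_conj openT (sw j).
rewrite (@cpartial_sum _ _ setT) //; last 1 first.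
- by move=> j; exact: (csmoothM openT (su j) (sc j)).
- by rewrite -big_split; apply: eq_bigr => j _;
    rewrite (@cpartialM _ _ setT) // (@cpartial_conj _ _ setT).
exact: openT.
Qed.

Lemma csmooth_fubini_study k l : csmooth setT (fun x => fubini_study v x k l).
Proof.
have oT := @openT V; have sN := csmooth_herm sv sv.
apply: csmoothB => //; apply: csmooth_div => //.
- exact: csmooth_herm (spv k) (spv l).
- by move=> x _; rewrite expf_neq0.
- exact: (csmoothM oT (csmooth_herm (spv k) sv) (csmooth_herm sv (spv l))).
- exact: (csmoothM oT sN sN).
Qed.

Lemma cpartial_fubini_study m k l x :
  cpartial m (fun y => fubini_study v y k l) x =
  fs_form_der (v^~ x) (fun k j => pv k j x) (fun m k j => cpartial m (pv k j) x) m k l.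
Proof.
have oT := @openT V; have sN := csmooth_herm sv sv.
have N0 (y : V) : setT y -> herm (v^~ y) (v^~ y) != 0 by [].
have sV := csmoothV oT N0 sN.
have s1 := csmooth_herm (spv k) (spv l).
have s2 := csmooth_herm (spv k) sv.
have s3 := csmooth_herm sv (spv l).
have s12 := csmoothM oT s1 sV.
have s23 := csmoothM oT s2 s3.
have sVV := csmoothM oT sV sV.
have s4 := csmoothM oT s23 sVV.
have -> : (fun y => fubini_study v y k l) =
    (fun y => herm (pv k ^~ y) (pv l ^~ y) * (herm (v^~ y) (v^~ y))^-1 -
      herm (pv k ^~ y) (v^~ y) * herm (v^~ y) (pv l ^~ y) *
      ((herm (v^~ y) (v^~ y))^-1 * (herm (v^~ y) (v^~ y))^-1)).
  by apply/funext => y; rewrite /fubini_study /fs_form expr2 invfM.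
rewrite (cpartialB _ oT s12 s4 I) (cpartialM _ s1 sV I) (cpartialM _ s23 sVV I).
rewrite (cpartialM _ s2 s3 I) (cpartialM _ sV sV I) (cpartialV _ oT N0 sN I).
move: (v0 x); rewrite !cpartial_herm // /fs_form_der {}/pv.
generalize (herm (v^~ x) (v^~ x)) => N nN.
do ![match goal with |- context [herm ?a ?b] => generalize (herm a b); intro end].
by field.
Qed.

Hypothesis hv : forall j, symmetric_hessian (v j).

Lemma fubini_study_closed k l m x :
  cpartial k (fun y => fubini_study v y l m - fubini_study v y m l) x
  + cpartial l (fun y => fubini_study v y m k - fubini_study v y k m) x
  + cpartial m (fun y => fubini_study v y k l - fubini_study v y l k) x = 0.
Proof.
have dB a b c := etrans
  (cpartialB a openT (csmooth_fubini_study b c) (csmooth_fubini_study c b) I)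
  (congr2 (fun p q => p - q) (cpartial_fubini_study a b c x)
    (cpartial_fubini_study a c b x)).
rewrite [X in X + _ + _]dB [X in _ + X + _]dB [X in _ + X]dB => {dB}.
cbv beta; apply: (@fs_form_der_cyclic _ _ _ (v^~ x) (fun k j => pv k j x)
  (fun m k j => cpartial m (pv k j) x) k l m (v0 x)) => a b.
by apply/funext => j; exact: hv.
Qed.

End Calculus.
End FubiniStudyForm.

(** * Generalized complex structures from complex and symplectic ones *)

Section SmoothMatrices.
Variables (R : realType) (V : normedModType R) (U : set V).
Hypothesis oU : open U.

Lemma smooth_onS (V' W : normedModType R) (A B : set V') (f : V' -> W) : A `<=` B ->
  smooth_on B f -> smooth_on A f.
Proof.
move=> AB sf k; elim: k f {sf}(sf k) => [|k IH] f /=.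
  by move=> cf x /AB /cf.
by move=> [df Cf]; split=> [x /AB /df //|v]; exact: IH.
Qed.

Lemma smooth_on_sum (I : Type) (r : seq I) (P : pred I) (F : I -> V -> R) :
  (forall i, smooth_on U (F i)) -> smooth_on U (fun x => \sum_(i <- r | P i) F i x).
Proof.
move=> sF k; have -> : (fun x => \sum_(i <- r | P i) F i x) = \sum_(i <- r | P i) F i.
  by apply/funext => x; rewrite fct_sumE.
elim/big_ind : _ => [|f g|i _]; [exact: smooth_on_cst|exact: Ck_onD|exact: sF].
Qed.

Lemma smooth_on_prod (I : Type) (r : seq I) (P : pred I) (F : I -> V -> R) :
  (forall i, smooth_on U (F i)) -> smooth_on U (fun x => \prod_(i <- r | P i) F i x).
Proof.
move=> sF; elim: r => [|i r IH].
  move=> k; apply: (@Ck_on_eq _ _ _ k U (fun=> 1 : R)) => // [x _|].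
    by rewrite big_nil.
  exact: smooth_on_cst.
have [Pi|nPi] := boolP (P i); last first.
  by move=> k; apply: Ck_on_eq oU _ (IH k) => x _; rewrite big_cons (negbTE nPi).
move=> k; apply: Ck_on_eq oU _ (Ck_onM oU (sF i k) (IH k)) => x _.
by rewrite big_cons Pi.
Qed.

Lemma smooth_on_det (n : nat) (A : V -> 'M[R]_n) :
  (forall i j, smooth_on U (fun x => A x i j)) -> smooth_on U (fun x => \det (A x)).
Proof.
move=> sA; apply: smooth_on_sum => s k /=.
apply: (Ck_onM oU) (smooth_on_cst U _ k) _.
by apply: smooth_on_prod => i; exact: sA.
Qed.

Lemma smooth_on_invmx (n : nat) (A : V -> 'M[R]_n) :
  (forall x, U x -> A x \in unitmx) ->
  (forall i j, smooth_on U (fun x => A x i j)) ->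
  forall i j, smooth_on U (fun x => invmx (A x) i j).
Proof.
move=> uA sA i j k; have d0 x : U x -> \det (A x) != 0.
  by move=> /uA; rewrite unitmxE unitfE.
have sadj : smooth_on U (fun x => (\adj (A x)) i j).
  apply: (@smooth_on_eq _ _ _ _ (fun x => (-1) ^+ (j + i) *
      \det (row' j (col' i (A x))))) => // [x _|k'].
    by rewrite mxE.
  apply: (Ck_onM oU) (smooth_on_cst U _ k') _.
  apply: smooth_on_det => a b.
  by move=> d; apply: Ck_on_eq oU _ (sA (lift j a) (lift i b) d) => x _; rewrite !mxE.
apply: Ck_on_eq oU _ (Ck_onM oU (Ck_onV oU d0 (smooth_on_det sA k)) (sadj k)) => x Ux.
by rewrite /invmx uA // mxE.
Qed.

Lemma smooth_on_block_mx (m1 m2 n1 n2 : nat) (A : V -> 'M[R]_(m1, n1))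
    (B : V -> 'M[R]_(m1, n2)) (C : V -> 'M[R]_(m2, n1)) (D : V -> 'M[R]_(m2, n2)) :
  (forall i j, smooth_on U (fun x => A x i j)) ->
  (forall i j, smooth_on U (fun x => B x i j)) ->
  (forall i j, smooth_on U (fun x => C x i j)) ->
  (forall i j, smooth_on U (fun x => D x i j)) ->
  smooth_on U (fun x => block_mx (A x) (B x) (C x) (D x)).
Proof.
move=> sA sB sC sD; apply: smooth_on_mx => // i j.
have [i' ->|i' ->] := split_ordP i; have [j' ->|j' ->] := split_ordP j.
- by move=> d; apply: Ck_on_eq oU _ (sA i' j' d) => x _; rewrite block_mxEul.
- by move=> d; apply: Ck_on_eq oU _ (sB i' j' d) => x _; rewrite block_mxEur.
- by move=> d; apply: Ck_on_eq oU _ (sC i' j' d) => x _; rewrite block_mxEdl.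
- by move=> d; apply: Ck_on_eq oU _ (sD i' j' d) => x _; rewrite block_mxEdr.
Qed.

End SmoothMatrices.

Section LinearAlgebra.
Variable F : fieldType.

Lemma tt_pairing_row n (X Y xi eta : 'rV[F]_n) :
  tt_pairing (row_mx X xi) (row_mx Y eta) =
  2^-1 * ((xi *m Y^T) 0 0 + (eta *m X^T) 0 0).
Proof.
rewrite /tt_pairing !row_mxKl !row_mxKr !mxE; congr (_ * (_ + _));
  by apply: eq_bigr => k _; rewrite mxE.
Qed.

Lemma mulmx_tr00 n (X Y : 'rV[F]_n) : (X *m Y^T) 0 0 = (Y *m X^T) 0 0.
Proof. by rewrite -[in RHS](trmxK Y) -trmx_mul [RHS]mxE. Qed.

Definition symplectic_mx n (W : 'M[F]_n) : 'M[F]_(n + n) :=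
  block_mx 0 W (- invmx W) 0.

Lemma mul_row_symplectic n (W : 'M[F]_n) (X xi : 'rV[F]_n) :
  row_mx X xi *m symplectic_mx W = row_mx (- (xi *m invmx W)) (X *m W).
Proof. by rewrite mul_row_block !mulmx0 add0r addr0 mulmxN. Qed.

Section Symplectic.
Variables (n : nat) (W : 'M[F]_n).
Hypotheses (Wu : W \in unitmx) (Wanti : W^T = - W).

Lemma symplectic_mx_sqr : symplectic_mx W *m symplectic_mx W = - 1%:M.
Proof.
rewrite mulmx_block !mulmx0 !mul0mx !addr0 !add0r mulmxN mulNmx mulmxV // mulVmx //.
by rewrite [in RHS]scalar_mx_block opp_block_mx !oppr0.
Qed.

Lemma tr_invmx_anti : (invmx W)^T = - invmx W.
Proof.
have NWu : -1 *: W \in unitmx by rewrite unitmxZ // unitrN1.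
by rewrite trmx_inv Wanti -scaleN1r invmxZ // invrN1 scaleN1r.
Qed.

Lemma symplectic_mx_pairing (u v : 'rV[F]_(n + n)) :
  tt_pairing (u *m symplectic_mx W) (v *m symplectic_mx W) = tt_pairing u v.
Proof.
have anti (X eta : 'rV[F]_n) : ((X *m W) *m (- (eta *m invmx W))^T) 0 0 =
    (eta *m X^T) 0 0.
  rewrite linearN /= trmx_mul tr_invmx_anti mulNmx opprK -mulmxA mulKVmx //.
  exact: mulmx_tr00.
rewrite -(hsubmxK u) -(hsubmxK v) !mul_row_symplectic !tt_pairing_row !anti.
by rewrite addrC.
Qed.

End Symplectic.

Definition complex_mx m : 'M[F]_(m + m) := block_mx 0 1%:M (- 1%:M) 0.

Lemma complex_mx_sqr m : complex_mx m *m complex_mx m = - 1%:M.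
Proof.
rewrite mulmx_block !mulmx0 !mul0mx !addr0 !add0r mulmx1 mul1mx.
by rewrite [in RHS]scalar_mx_block opp_block_mx !oppr0.
Qed.

Lemma complex_mx_tr m : (complex_mx m)^T = - complex_mx m.
Proof.
by rewrite tr_block_mx opp_block_mx !trmx0 !oppr0 linearN /= !trmx1 opprK.
Qed.

Definition double_complex_mx m : 'M[F]_(m + m + (m + m)) :=
  block_mx (complex_mx m) 0 0 (complex_mx m).

Lemma double_complex_mx_sqr m : double_complex_mx m *m double_complex_mx m = - 1%:M.
Proof.
rewrite mulmx_block !mulmx0 !mul0mx !addr0 !add0r complex_mx_sqr.
by rewrite [in RHS]scalar_mx_block opp_block_mx !oppr0.
Qed.

Lemma double_complex_mx_pairing m (u v : 'rV[F]_(m + m + (m + m))) :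
  tt_pairing (u *m double_complex_mx m) (v *m double_complex_mx m) = tt_pairing u v.
Proof.
have JJ (X Y : 'rV[F]_(m + m)) :
    (X *m complex_mx m) *m (Y *m complex_mx m)^T = X *m Y^T.
  rewrite trmx_mul complex_mx_tr mulmxA -(mulmxA X) mulmxN complex_mx_sqr opprK.
  by rewrite mulmx1.
rewrite -(hsubmxK u) -(hsubmxK v) !mul_row_block !mulmx0 !addr0 !add0r.
by rewrite !tt_pairing_row !JJ.
Qed.

End LinearAlgebra.

(** * Involutivity *)

Section CourantSections.
Variables (R : realType) (n : nat).
Local Notation C := R[i].
Local Notation V := 'rV[R]_n.
Variable U : set V.
Hypothesis oU : open U.

Lemma csmooth_section_coord p (Z : V -> 'rV[C]_p) j :
  csmooth_section U Z -> csmooth U (fun x => Z x 0 j).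
Proof.
case=> s1 s2; split=> k.
  by apply: Ck_on_eq oU _ (smooth_on_comp_coord 0 j oU s1 k) => x _; rewrite mxE.
by apply: Ck_on_eq oU _ (smooth_on_comp_coord 0 j oU s2 k) => x _; rewrite mxE.
Qed.

Lemma csmooth_lsubmx (Z : V -> 'rV[C]_(n + n)) j : csmooth_section U Z ->
  csmooth U (fun x => lsubmx (Z x) 0 j).
Proof.
move=> sZ; apply: csmooth_eq (csmooth_section_coord (lshift n j) sZ) => x.
by rewrite mxE.
Qed.

Lemma csmooth_rsubmx (Z : V -> 'rV[C]_(n + n)) j : csmooth_section U Z ->
  csmooth U (fun x => rsubmx (Z x) 0 j).
Proof.
move=> sZ; apply: csmooth_eq (csmooth_section_coord (rshift n j) sZ) => x.
by rewrite mxE.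
Qed.

End CourantSections.

Section ComplexInvolutive.
Variables (R : realType) (m : nat).
Local Notation C := R[i].
Local Notation V := 'rV[R]_(m + m).

Lemma mulCi : 'i%C * 'i%C = -1 :> C.
Proof. by rewrite -expr2 sqr_i. Qed.

Lemma complex_mx_eigenP (X : 'rV[C]_(m + m)) :
  X *m map_mx (real_complex R) (complex_mx R m) = 'i%C *: X <->
  forall k, X 0 (rshift m k) = - 'i%C * X 0 (lshift m k).
Proof.
rewrite map_block_mx !map_mx0 map_mxN map_mx1 -{1 2}(hsubmxK X).
rewrite mul_row_block !mulmx0 add0r addr0 mulmxN !mulmx1 scale_row_mx.
split=> [/eq_row_mx[_ E] k|E].
  have /rowP/(_ k) := E; rewrite !mxE => ->.
  by rewrite mulrA mulNr mulCi opprK mul1r.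
congr row_mx; apply/rowP => k; rewrite !mxE E mulNr ?opprK //.
by rewrite mulrN mulrA mulCi mulN1r opprK.
Qed.

Variables (U : set V).
Hypothesis oU : open U.

Lemma complex_involutive (A B : V -> 'rV[C]_(m + m + (m + m))) :
  csmooth_section U A -> csmooth_section U B ->
  (forall x, U x -> A x *m map_mx (real_complex R) (double_complex_mx R m)
    = 'i%C *: A x) ->
  (forall x, U x -> B x *m map_mx (real_complex R) (double_complex_mx R m)
    = 'i%C *: B x) ->
  forall x, U x -> courant A B x *m map_mx (real_complex R) (double_complex_mx R m)
    = 'i%C *: courant A B x.
Proof.
pose J := map_mx (real_complex R) (complex_mx R m).
have -> : map_mx (real_complex R) (double_complex_mx R m) = block_mx J 0 0 J.
  by rewrite map_block_mx !map_mx0.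
have eigP (X xi : 'rV[C]_(m + m)) :
    row_mx X xi *m block_mx J 0 0 J = 'i%C *: row_mx X xi <->
    (forall k, X 0 (rshift m k) = - 'i%C * X 0 (lshift m k)) /\
    (forall k, xi 0 (rshift m k) = - 'i%C * xi 0 (lshift m k)).
  rewrite mul_row_block !mulmx0 addr0 add0r scale_row_mx.
  by rewrite -!complex_mx_eigenP -/J; split=> [/eq_row_mx[-> ->]|[-> ->]].
move=> sA sB eA eB.
pose X x := lsubmx (A x); pose xi x := rsubmx (A x).
pose Y x := lsubmx (B x); pose eta x := rsubmx (B x).
have eXxi x (Ux : U x) : (forall k, X x 0 (rshift m k) =
    - 'i%C * X x 0 (lshift m k)) /\ (forall k, xi x 0 (rshift m k) =
    - 'i%C * xi x 0 (lshift m k)).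
  by apply/eigP; rewrite hsubmxK; exact: eA.
have eYeta x (Ux : U x) : (forall k, Y x 0 (rshift m k) =
    - 'i%C * Y x 0 (lshift m k)) /\ (forall k, eta x 0 (rshift m k) =
    - 'i%C * eta x 0 (lshift m k)).
  by apply/eigP; rewrite hsubmxK; exact: eB.
have dE (Z : V -> 'rV[C]_(m + m)) : (forall j, csmooth U (fun x => Z x 0 j)) ->
    (forall x, U x -> forall k, Z x 0 (rshift m k) = - 'i%C * Z x 0 (lshift m k)) ->
    forall x l k, U x -> cpartial l (fun y => Z y 0 (rshift m k)) x =
      - 'i%C * cpartial l (fun y => Z y 0 (lshift m k)) x.
  move=> sZ eZ x l k Ux.
  rewrite (eq_cpartial l oU (fun y Uy => eZ y Uy k) Ux).
  exact: cpartialZ oU (sZ _) Ux.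
have dX := dE X (fun j => csmooth_lsubmx oU j sA) (fun x Ux => (eXxi x Ux).1).
have dY := dE Y (fun j => csmooth_lsubmx oU j sB) (fun x Ux => (eYeta x Ux).1).
have dxi := dE xi (fun j => csmooth_rsubmx oU j sA) (fun x Ux => (eXxi x Ux).2).
have deta := dE eta (fun j => csmooth_rsubmx oU j sB) (fun x Ux => (eYeta x Ux).2).
have isotropic (u w : 'I_(m + m) -> C) :
    (forall k, u (rshift m k) = - 'i%C * u (lshift m k)) ->
    (forall k, w (rshift m k) = - 'i%C * w (lshift m k)) -> \sum_k u k * w k = 0.
  move=> eu ew; rewrite big_split_ord /= -big_split big1 // => k _ /=.
  by rewrite eu ew mulrACA mulrNN mulCi mulN1r subrr.
have contract0 (Z zeta : V -> 'rV[C]_(m + m)) x : U x ->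
    (forall x, U x -> forall k, Z x 0 (rshift m k) = - 'i%C * Z x 0 (lshift m k)) ->
    (forall x, U x -> forall k,
      zeta x 0 (rshift m k) = - 'i%C * zeta x 0 (lshift m k)) ->
    ext_d (Defs.contract Z zeta) x = 0.
  move=> Ux eZ ezeta; apply/rowP => k; rewrite !mxE -[RHS](cpartial_cst k 0 x).
  by apply: eq_cpartial oU _ Ux => y Uy; apply: isotropic; [exact: eZ|exact: ezeta].
move=> x Ux; rewrite /courant.
rewrite !contract0 //; [|by move=> y /eYeta[]|by move=> y /eXxi[]
  |by move=> y /eXxi[]|by move=> y /eYeta[]].
rewrite [X in 2^-1 *: X]subrr [X in _ - X]scaler0 [X in row_mx _ X]subr0.
apply/eigP; split=> k.
  rewrite !mxE mulr_sumr; apply: eq_bigr => l _.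
  by rewrite dY // dX // mulrBr !(mulrCA _ (- 'i%C)).
have lieE (Z zeta : V -> 'rV[C]_(m + m)) j :
    (forall k, zeta x 0 (rshift m k) = - 'i%C * zeta x 0 (lshift m k)) ->
    (forall k, cpartial j (fun y => Z y 0 (rshift m k)) x =
      - 'i%C * cpartial j (fun y => Z y 0 (lshift m k)) x) ->
    lie_derivative Z zeta x 0 j =
    \sum_l Z x 0 l * cpartial l (fun y => zeta y 0 j) x.
  move=> ez eZ; rewrite mxE big_split /= [X in _ + X](_ : _ = 0) ?addr0 //.
  exact: (isotropic (fun l => zeta x 0 l) (fun l => cpartial j (fun y => Z y 0 l) x)).
have rowB (a b : 'rV[C]_(m + m)) j : (a - b) 0 j = a 0 j - b 0 j by rewrite !mxE.
rewrite [LHS]rowB [X in _ * X]rowB.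
have L1 j := lieE X eta j (eYeta x Ux).2 (fun k => dX x j k Ux).
have L2 j := lieE Y xi j (eXxi x Ux).2 (fun k => dY x j k Ux).
rewrite [X in X - _]L1 [X in _ - X = _]L2 [X in _ * (X - _)]L1 [X in _ * (_ - X)]L2.
rewrite mulrBr !mulr_sumr; congr (_ - _); apply: eq_bigr => l _.
  by rewrite deta // mulrCA.
by rewrite dxi // mulrCA.
Qed.

End ComplexInvolutive.

Section SymplecticInvolutive.
Variables (R : realType) (n : nat).
Local Notation C := R[i].
Local Notation V := 'rV[R]_n.

Definition closed_form_on (U : set V) (W : V -> 'M[R]_n) : Prop :=
  forall x, U x -> forall k l m,
    cpartial k (fun y => (W y l m)%:C%C) x + cpartial l (fun y => (W y m k)%:C%C) x
    + cpartial m (fun y => (W y k l)%:C%C) x = 0.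

(* [dX l a] stands for the derivative of [X a] in the direction [l]. *)
Lemma symplectic_bracket (I : finType) (c : C) (X Y : I -> C) (dX dY w : I -> I -> C)
    (dw : I -> I -> I -> C) :
  (forall a b, w a b = - w b a) -> (forall l a b, dw l a b = - dw l b a) ->
  (forall k l m, dw k l m + dw l m k + dw m k l = 0) ->
  let xi k := c * \sum_a X a * w a k in let eta k := c * \sum_a Y a * w a k in
  let dxi l k := c * \sum_a (dX l a * w a k + X a * dw l a k) in
  let deta l k := c * \sum_a (dY l a * w a k + Y a * dw l a k) in
  forall k, \sum_l (X l * deta l k - Y l * dxi l k - xi l * dY k l - X l * deta k l) =
    c * \sum_a (\sum_l (X l * dY l a - Y l * dX l a)) * w a k.
Proof.
move=> wN dwN dwc xi eta dxi deta k.
pose S (f : I -> I -> C) := \sum_l \sum_a f l a.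
have SC f : S f = S (fun l a => f a l) by exact: exchange_big.
have SD f g : S f + S g = S (fun l a => f l a + g l a).
  by rewrite -big_split; apply: eq_bigr => l _; rewrite -big_split.
have SZ d f : d * S f = S (fun l a => d * f l a).
  by rewrite mulr_sumr; apply: eq_bigr => l _; rewrite mulr_sumr.
have eS f g : (forall l a, f l a = g l a) -> S f = S g.
  by move=> fg; apply: eq_bigr => l _; apply: eq_bigr => a _; exact: fg.
have -> : \sum_l (X l * deta l k - Y l * dxi l k - xi l * dY k l - X l * deta k l) =
    c * (S (fun l a => X l * (dY l a * w a k + Y a * dw l a k)
      - Y l * dX l a * w a k - X l * (dY k a * w a l + Y a * dw k a l)) +
    (S (fun l a => - (X a * w a l * dY k l)) + S (fun l a => - (Y l * X a * dw l a k)))).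
  rewrite !SD SZ; apply: eq_bigr => l _.
  rewrite /deta /dxi /xi mulrCA (mulrCA (Y l)) -mulrA (mulrCA (X l)) -!mulrBr -mulr_sumr.
  congr (_ * _); rewrite mulr_suml !mulr_sumr -!sumrB; apply: eq_bigr => a _.
  by ring.
rewrite (SC (fun l a => - (X a * w a l * dY k l))).
rewrite (SC (fun l a => - (Y l * X a * dw l a k))) !SD.
have -> : \sum_a (\sum_l (X l * dY l a - Y l * dX l a)) * w a k =
    S (fun l a => (X l * dY l a - Y l * dX l a) * w a k).
  by rewrite [RHS]SC; apply: eq_bigr => a _; rewrite mulr_suml.
congr (_ * _); apply: eS => l a.
have E := dwc l a k; rewrite (wN a l) (dwN k a l) (dwN a l k).
have -> : dw l a k = - dw a k l - dw k l a.
  by apply/eqP; rewrite -subr_eq0 !opprD !opprK addrA E.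
by ring.
Qed.

Lemma closed_form_onD (U : set V) (W W' : V -> 'M[R]_n) : open U ->
  smooth_on U W -> smooth_on U W' -> closed_form_on U W -> closed_form_on U W' ->
  closed_form_on U (fun x => W x + W' x).
Proof.
move=> oU sW sW' cW cW' x Ux k l m.
have E a b d : cpartial a (fun y => ((W y + W' y) b d)%:C%C) x =
    cpartial a (fun y => (W y b d)%:C%C) x + cpartial a (fun y => (W' y b d)%:C%C) x.
  rewrite -(cpartialD a (csmooth_real (smooth_on_comp_coord b d oU sW))
    (csmooth_real (smooth_on_comp_coord b d oU sW')) Ux).
  by congr (cpartial a _ x); apply/funext => y; rewrite mxE rmorphD.
have sum3 (p q p' q' p'' q'' : C) :
    p + q + (p' + q') + (p'' + q'') = p + p' + p'' + (q + q' + q'') by ring.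
by rewrite !E [LHS]sum3 (cW x Ux) (cW' x Ux) addr0.
Qed.

Variables (U : set V) (W : V -> 'M[R]_n) (c : C).
Hypotheses (oU : open U) (sW : smooth_on U W).
Hypothesis anti : forall x, U x -> (W x)^T = - W x.
Hypothesis closed : closed_form_on U W.

Lemma symplectic_involutive (A B : V -> 'rV[C]_(n + n)) :
  csmooth_section U A -> csmooth_section U B ->
  (forall x, U x -> rsubmx (A x) =
    c *: (lsubmx (A x) *m map_mx (real_complex R) (W x))) ->
  (forall x, U x -> rsubmx (B x) =
    c *: (lsubmx (B x) *m map_mx (real_complex R) (W x))) ->
  forall x, U x -> rsubmx (courant A B x) =
    c *: (lsubmx (courant A B x) *m map_mx (real_complex R) (W x)).
Proof.
move=> sA sB eA eB x Ux.
pose w (a k : 'I_n) y : C := (W y a k)%:C%C.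
have sw a k : csmooth U (w a k) by exact: csmooth_real (smooth_on_comp_coord a k oU sW).
have wN a k y : U y -> w a k y = - w k a y.
  move=> Uy; have /matrixP/(_ k a) := anti Uy; rewrite !mxE /w => ->.
  by rewrite rmorphN.
have dwN l a k : cpartial l (w a k) x = - cpartial l (w k a) x.
  rewrite -mulN1r -(cpartialZ l (-1) oU (sw k a) Ux).
  by apply: eq_cpartial oU _ Ux => y Uy; rewrite mulN1r; exact: wN.
have dE (Z zeta : V -> 'rV[C]_n) : (forall j, csmooth U (fun y => Z y 0 j)) ->
    (forall y, U y -> zeta y = c *: (Z y *m map_mx (real_complex R) (W y))) ->
    forall l k, cpartial l (fun y => zeta y 0 k) x =
    c * \sum_a (cpartial l (fun y => Z y 0 a) x * w a k x
                + Z x 0 a * cpartial l (w a k) x).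
  move=> sZ eZ l k.
  have sZw a := csmoothM oU (sZ a) (sw a k).
  have e y : U y -> zeta y 0 k = c * \sum_a Z y 0 a * w a k y.
    by move=> /eZ ->; rewrite !mxE; congr (_ * _); apply: eq_bigr => a _; rewrite mxE.
  rewrite (eq_cpartial l oU e Ux).
  rewrite (cpartialZ l c oU (csmooth_sum _ _ oU sZw) Ux) (cpartial_sum _ _ _ oU sZw Ux).
  by congr (_ * _); apply: eq_bigr => a _; exact: cpartialM (sZ a) (sw a k) Ux.
pose X y := lsubmx (A y); pose xi y := rsubmx (A y).
pose Y y := lsubmx (B y); pose eta y := rsubmx (B y).
have sX j : csmooth U (fun y => X y 0 j) by exact: csmooth_lsubmx.
have sY j : csmooth U (fun y => Y y 0 j) by exact: csmooth_lsubmx.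
have seta j : csmooth U (fun y => eta y 0 j) by exact: csmooth_rsubmx.
have dxi := dE X xi sX eA; have deta := dE Y eta sY eB.
have sXeta a := csmoothM oU (sX a) (seta a).
have dcontract k : cpartial k (Defs.contract Y xi) x =
    - cpartial k (Defs.contract X eta) x.
  rewrite -mulN1r -(cpartialZ k (-1) oU (csmooth_sum _ _ oU sXeta) Ux).
  apply: eq_cpartial oU _ Ux => y Uy.
  rewrite /Defs.contract /xi /eta eA // eB // mulN1r -sumrN.
  under eq_bigr do rewrite !mxE mulrCA mulr_sumr.
  under [RHS]eq_bigr do rewrite !mxE mulrCA mulr_sumr -mulrN -sumrN.
  rewrite -!mulr_sumr; congr (_ * _).
  rewrite exchange_big; apply: eq_bigr => a _; apply: eq_bigr => b _.
  by rewrite !mxE -/(w a b y) -/(w b a y) (wN a b) //; ring.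
apply/rowP => k; rewrite row_mxKr row_mxKl.
have rowE (a b d e : 'rV[C]_n) : (a - b - 2^-1 *: (d - e)) 0 k =
    a 0 k - b 0 k - 2^-1 * (d 0 k - e 0 k) by rewrite !mxE.
rewrite [LHS]rowE ![ext_d _ _ 0 k]mxE dcontract opprK -mulr2n.
rewrite -[X in 2^-1 * X]mulr_natl mulKf ?pnatr_eq0 //.
have -> : cpartial k (Defs.contract X eta) x = \sum_l
    (cpartial k (fun y => X y 0 l) x * eta x 0 l
     + X x 0 l * cpartial k (fun y => eta y 0 l) x).
  rewrite (cpartial_sum _ _ _ oU sXeta Ux); apply: eq_bigr => l _.
  exact: cpartialM (sX l) (seta l) Ux.
rewrite [lie_derivative _ _ _ _ _]mxE [lie_derivative Y _ _ _ _]mxE -!sumrB.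
have bracketE : (c *: (lie_bracket X Y x *m map_mx (real_complex R) (W x))) 0 k =
    c * \sum_a (\sum_l (X x 0 l * cpartial l (fun y => Y y 0 a) x
      - Y x 0 l * cpartial l (fun y => X y 0 a) x)) * w a k x.
  by rewrite !mxE; congr (_ * _); apply: eq_bigr => a _; rewrite !mxE.
rewrite [RHS]bracketE.
have := @symplectic_bracket _ c (X x 0) (Y x 0)
  (fun l a => cpartial l (fun y => X y 0 a) x)
  (fun l a => cpartial l (fun y => Y y 0 a) x) (fun a b => w a b x)
  (fun l a b => cpartial l (w a b) x) (fun a b => wN a b x Ux) dwN (closed Ux) k.
cbv zeta beta => <-; apply: eq_bigr => l _.
have exi : xi x 0 l = c * \sum_a X x 0 a * w a l x.
  rewrite [xi x]eA // !mxE; congr (_ * _); apply: eq_bigr => a _.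
  by rewrite [map_mx _ _ _ _]mxE.
have cancel (a b h z e1 e2 e3 d1 d2 : C) :
    a * e1 + h * d1 - (b * e2 + z * d2) - (d1 * h + a * e3) =
    a * e1 - b * e2 - z * d2 - a * e3 by ring.
apply: etrans (cancel (X x 0 l) (Y x 0 l) (eta x 0 l) (xi x 0 l)
  (cpartial l (fun y => eta y 0 k) x) (cpartial l (fun y => xi y 0 k) x)
  (cpartial k (fun y => eta y 0 l) x) (cpartial k (fun y => X y 0 l) x)
  (cpartial k (fun y => Y y 0 l) x)) _.
by congr (_ * _ - _ * _ - _ * _ - _ * _).
Qed.

End SymplecticInvolutive.

(** * Pseudo-Kaehler manifolds *)

Section PseudoKahlerMatrices.
Variables (F : numFieldType) (n : nat) (S : 'M[F]_n) (e : F).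
Hypotheses (Su : S \in unitmx) (Ssym : S^T = S) (ee : e * e = 1).

Let G : 'M[F]_(n + n) := block_mx 0 S (invmx S) 0.

Lemma eigenspace_graphP (X xi : 'rV[F]_n) :
  (row_mx X xi <= eigenspace G e)%MS <-> xi = e *: (X *m S).
Proof.
have E : row_mx X xi *m G = row_mx (xi *m invmx S) (X *m S).
  by rewrite mul_row_block !mulmx0 add0r addr0.
split=> [/eigenspaceP|xiE].
  by rewrite E scale_row_mx => /eq_row_mx[_ ->]; rewrite scalerA ee scale1r.
apply/eigenspaceP; rewrite E scale_row_mx xiE scalerA ee scale1r.
by rewrite -scalemxAl mulmxK.
Qed.

Lemma eigenspace_graph_nondegenerate (u : 'rV[F]_(n + n)) :
  (u <= eigenspace G e)%MS ->
  (forall v : 'rV[F]_(n + n), (v <= eigenspace G e)%MS -> tt_pairing u v = 0) -> u = 0.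
Proof.
rewrite -(hsubmxK u); move: (lsubmx u) (rsubmx u) => X xi /eigenspace_graphP ->.
move=> H; suff -> : X = 0 by rewrite mul0mx scaler0 row_mx0.
have e0 : e != 0 by apply: contraTneq (oner_neq0 F) => e0; rewrite -ee e0 mul0r eqxx.
suff XS0 : X *m S = 0 by rewrite -(mulmxK Su X) XS0 mul0mx.
apply/rowP => k; rewrite [RHS]mxE.
have := H (row_mx (delta_mx 0 k) (e *: (delta_mx 0 k *m S))).
move=> /(_ (iffRL (eigenspace_graphP _ _) erefl)); rewrite tt_pairing_row.
rewrite [X in _ + X]mulmx_tr00 linearZ /= trmx_mul Ssym -scalemxAl -scalemxAr.
rewrite mulmxA trmx_delta -colE !mxE -mulr2n -[X in _ * X]mulr_natl mulKf ?pnatr_eq0 //.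
by move=> /eqP; rewrite mulf_eq0 (negbTE e0) /= => /eqP.
Qed.

End PseudoKahlerMatrices.

Lemma eigenspace_graph_transversal (R : realType) (n : nat) (S : 'M[R]_n) (e : R) :
  S \in unitmx -> e * e = 1 ->
  transversal_to_TM (eigenspace (block_mx 0 S (invmx S) 0) e).
Proof.
move=> Su ee; rewrite /transversal_to_TM -sub1mx; apply/row_subP => i.
move: (row i _) => u; rewrite -(hsubmxK u).
move: (lsubmx u) (rsubmx u) => X xi.
have -> : row_mx X xi = row_mx (e *: (xi *m invmx S)) xi
    + (X - e *: (xi *m invmx S)) *m tangent_mx R n.
  by rewrite mul_mx_row mulmx1 mulmx0 add_row_mx addr0 addrC subrK.
apply: addmx_sub_adds; last exact: submxMl.
by apply/eigenspace_graphP => //; rewrite -scalemxAl mulmxKV // scalerA ee scale1r.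
Qed.

Lemma symplectic_mx_eigenP (R : realType) (n : nat) (W : 'M[R]_n)
    (X xi : 'rV[R[i]]_n) : W \in unitmx ->
  row_mx X xi *m map_mx (real_complex R) (symplectic_mx W) = 'i%C *: row_mx X xi <->
  xi = - 'i%C *: (X *m map_mx (real_complex R) W).
Proof.
move=> Wu; rewrite /symplectic_mx map_block_mx !map_mx0 map_mxN map_invmx.
have Wu' : map_mx (real_complex R) W \in unitmx by rewrite map_unitmx.
rewrite mul_row_block !mulmx0 add0r addr0 scale_row_mx.
split=> [/eq_row_mx[_ ->]|->].
  by rewrite scalerA mulNr mulCi opprK scale1r.
rewrite scalerA mulrN mulCi opprK scale1r; congr row_mx.
by rewrite mulmxN -scalemxAl mulmxK // scaleNr opprK.
Qed.

Section PseudoKahlerManifold.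
Variables (R : realType) (m : nat) (M : smooth_manifold R (m + m)).
Variable W : Defs.index M -> 'rV[R]_(m + m) -> 'M[R]_(m + m).

Local Notation J := (complex_mx R m).
Local Notation trans := (transition (@dom R (m + m) M) (@par R (m + m) M)).
Local Notation ovl := (overlap (@dom R (m + m) M) (@par R (m + m) M)).

Hypothesis cauchy_riemann_trans : forall i j x, ovl i j x ->
  J *m jacobian (trans i j) x = jacobian (trans i j) x *m J.
Hypothesis W_smooth : forall i, smooth_on (dom i) (W i).
Hypothesis W_anti : forall i x, dom i x -> (W i x)^T = - W i x.
Hypothesis W_unit : forall i x, dom i x -> W i x \in unitmx.
Hypothesis W_closed : forall i, closed_form_on (dom i) (W i).
Hypothesis W_complex : forall i x, dom i x -> W i x *m J = J *m W i x.
Hypothesis W_trans : forall i j x, ovl i j x ->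
  W i x = jacobian (trans i j) x *m W j (trans i j x) *m (jacobian (trans i j) x)^T.

Lemma trans_dom i j x : ovl i j x -> dom j (trans i j x).
Proof.
case=> _ [y dy E]; rewrite (@transition_eq _ _ _ _ _ _ i j x y) //.
by move=> y1 y2; exact: par_inj.
Qed.

Lemma comm_invmx (D K : 'M[R]_(m + m)) : K *m D = D *m K ->
  K *m invmx D = invmx D *m K.
Proof.
move=> KD; have [Du|nDu] := boolP (D \in unitmx); last by rewrite invmx_out.
by rewrite -[LHS](mulKmx Du) (mulmxA D) -KD -mulmxA mulmxV // mulmx1.
Qed.

Lemma complex_endo_compat i j x : ovl i j x ->
  double_complex_mx R m *m tt_cocycle i j x =
  tt_cocycle i j x *m double_complex_mx R m.
Proof.
move=> /cauchy_riemann_trans JD; rewrite /tt_cocycle.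
move: (jacobian _ _) JD => D JD.
rewrite !mulmx_block !mulmx0 !mul0mx !addr0 !add0r JD; congr block_mx.
have := congr1 trmx (comm_invmx JD); rewrite !trmx_mul complex_mx_tr.
by rewrite mulmxN mulNmx => /oppr_inj.
Qed.

Lemma symplectic_endo_smooth i : smooth_on (dom i) (fun x => symplectic_mx (W i x)).
Proof.
have oU := @dom_open _ _ M i.
have sW a b := smooth_on_comp_coord a b oU (@W_smooth i).
apply: smooth_on_block_mx => // a b.
- by apply: smooth_on_eq oU _ (smooth_on_cst _ 0) => x _; rewrite mxE.
- move=> k; apply: Ck_on_eq oU _
    (Ck_onN oU (smooth_on_invmx oU (@W_unit i) sW a b k)) => x _.
  by rewrite mxE.
- by apply: smooth_on_eq oU _ (smooth_on_cst _ 0) => x _; rewrite mxE.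
Qed.

Lemma symplectic_endo_compat i j x : ovl i j x ->
  symplectic_mx (W i x) *m tt_cocycle i j x =
  tt_cocycle i j x *m symplectic_mx (W j (trans i j x)).
Proof.
move=> ov; have Wi := W_unit ov.1; have Wj := W_unit (trans_dom ov).
have := W_trans ov; rewrite /tt_cocycle.
move: (jacobian _ _) (W i x) (W j _) Wi Wj => D Wi' Wj' Wi Wj WE.
have Du : D \in unitmx by move: Wi; rewrite WE !unitmx_mul => /andP[/andP[]].
have E : Wi' *m (invmx D)^T = D *m Wj'.
  by rewrite WE trmx_inv -!mulmxA mulmxV ?unitmx_tr // mulmx1.
rewrite !mulmx_block !mulmx0 !mul0mx !addr0 !add0r E; congr block_mx.
rewrite mulNmx mulmxN; congr (- _).
by rewrite -[in LHS](mulmxK Wj D) -E -!mulmxA mulKmx.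
Qed.

Definition complex_endo : tt_endo M :=
  TTEndo (fun i => smooth_on_cst _ _) complex_endo_compat.

Definition symplectic_endo : tt_endo M :=
  TTEndo symplectic_endo_smooth symplectic_endo_compat.

Lemma complex_endo_generalized_complex : generalized_complex complex_endo.
Proof.
split=> [i x _|i x _ u v|i U oU _ A B sA sB eA eB].
- exact: double_complex_mx_sqr.
- exact: double_complex_mx_pairing.
- exact: complex_involutive oU _ _ sA sB eA eB.
Qed.

Lemma symplectic_endo_generalized_complex : generalized_complex symplectic_endo.
Proof.
split=> [i x dx|i x dx u v|i U oU sub A B sA sB eA eB x Ux] /=.
- by rewrite symplectic_mx_sqr // W_unit.
- by rewrite symplectic_mx_pairing ?W_unit ?W_anti.
rewrite -[courant A B x]hsubmxK; apply/symplectic_mx_eigenP; first exact/W_unit/sub.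
apply: (@symplectic_involutive _ _ U (W i)) => //.
- exact: smooth_onS sub (@W_smooth i).
- by move=> y /sub; exact: W_anti.
- by move=> y /sub; exact: W_closed.
- move=> y Uy; apply/symplectic_mx_eigenP; first exact/W_unit/sub.
  by rewrite hsubmxK; exact: eA.
- move=> y Uy; apply/symplectic_mx_eigenP; first exact/W_unit/sub.
  by rewrite hsubmxK; exact: eB.
Qed.

Theorem generalized_pseudo_kahler_of_pseudo_kahler :
  generalized_pseudo_kahler complex_endo symplectic_endo.
Proof.
split; [exact: complex_endo_generalized_complex|
  exact: symplectic_endo_generalized_complex|move=> i x dx /=|move=> i x dx /=].
  have WJ := W_complex dx; have WJi := comm_invmx (esym WJ).
  by rewrite !mulmx_block !mulmx0 !mul0mx !addr0 !add0r WJ mulmxN mulNmx WJi.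
have Wu := W_unit dx; have WJ := W_complex dx; have WJi := comm_invmx (esym WJ).
have Ju : J \in unitmx.
  by apply: (@mulmx1_unit _ _ _ (- J) _).1; rewrite mulmxN complex_mx_sqr opprK.
have Su : W i x *m J \in unitmx by rewrite unitmx_mul Wu.
have Ssym : (W i x *m J)^T = W i x *m J.
  by rewrite trmx_mul complex_mx_tr W_anti // mulNmx mulmxN opprK WJ.
have -> : symplectic_mx (W i x) *m double_complex_mx R m =
    block_mx 0 (W i x *m J) (invmx (W i x *m J)) 0.
  rewrite mulmx_block !mulmx0 !mul0mx !addr0 !add0r; congr block_mx.
  have SI : W i x *m J *m (- invmx (W i x) *m J) = 1%:M.
    rewrite mulNmx mulmxN -WJi mulmxA -(mulmxA (W i x)) complex_mx_sqr.
    by rewrite mulmxN mulmx1 mulNmx opprK mulmxV.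
  by rewrite -[LHS](mulKmx Su) SI mulmx1.
by split; do ?[apply: eigenspace_graph_transversal|
  apply: eigenspace_graph_nondegenerate]; rewrite ?mulr1 ?mulrNN ?mulr1.
Qed.

End PseudoKahlerManifold.

(** * Holomorphic functions *)

Section Holomorphic.
Variables (R : realType) (m : nat).
Local Notation C := R[i].
Local Notation V := 'rV[R]_(m + m).
Implicit Types (f g : V -> C) (U : set V) (x : V).

Definition cauchy_riemann f x : Prop := forall k,
  cpartial (rshift m k) f x = 'i%C * cpartial (lshift m k) f x.

Lemma cauchy_riemann_cst (c : C) x : cauchy_riemann (fun=> c) x.
Proof. by move=> k; rewrite !cpartial_cst mulr0. Qed.

Lemma cauchy_riemannD U f g x : csmooth U f -> csmooth U g -> U x ->
  cauchy_riemann f x -> cauchy_riemann g x ->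
  cauchy_riemann (fun y => f y + g y) x.
Proof.
move=> sf sg Ux cf cg k.
rewrite [LHS](cpartialD _ sf sg Ux) [X in _ = _ * X](cpartialD _ sf sg Ux).
by rewrite cf cg mulrDr.
Qed.

Lemma cauchy_riemannM U f g x : csmooth U f -> csmooth U g -> U x ->
  cauchy_riemann f x -> cauchy_riemann g x ->
  cauchy_riemann (fun y => f y * g y) x.
Proof.
move=> sf sg Ux cf cg k.
rewrite [LHS](cpartialM _ sf sg Ux) [X in _ = _ * X](cpartialM _ sf sg Ux).
by rewrite cf cg mulrDr (mulrCA (f x)) -mulrA.
Qed.

Lemma cauchy_riemannV U f x : open U -> (forall y, U y -> f y != 0) ->
  csmooth U f -> U x -> cauchy_riemann f x -> cauchy_riemann (fun y => (f y)^-1) x.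
Proof.
move=> oU f0 sf Ux cf k.
rewrite [LHS](cpartialV _ oU f0 sf Ux) [X in _ = _ * X](cpartialV _ oU f0 sf Ux).
by rewrite cf mulrA mulrN.
Qed.

(* The symmetry of the second derivatives holds for all smooth functions; making
   it part of the definition avoids proving Schwarz's theorem. *)
Definition entire f : Prop :=
  [/\ csmooth setT f, symmetric_hessian f & forall x, cauchy_riemann f x].

Lemma entire_cst (c : C) : entire (fun=> c).
Proof.
split=> [|k l x|x]; [exact: csmooth_cst| |exact: cauchy_riemann_cst].
have E j : cpartial j (fun=> c) = fun _ : V => 0.
  by apply/funext => y; exact: cpartial_cst.
by rewrite !E !cpartial_cst.
Qed.

Lemma entireD f g : entire f -> entire g -> entire (fun x => f x + g x).
Proof.
move=> [sf hf cf] [sg hg cg]; have oT := @openT V.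
split=> [|k l x|x]; first exact: csmoothD.
- have E j : cpartial j (fun y => f y + g y) = fun y => cpartial j f y + cpartial j g y.
    by apply/funext => y; exact: cpartialD sf sg I.
  rewrite !E [LHS](cpartialD _ (csmooth_cpartial l sf) (csmooth_cpartial l sg) I).
  rewrite [RHS](cpartialD _ (csmooth_cpartial k sf) (csmooth_cpartial k sg) I).
  by rewrite hf hg.
- exact: cauchy_riemannD sf sg I (cf x) (cg x).
Qed.

Lemma entireM f g : entire f -> entire g -> entire (fun x => f x * g x).
Proof.
move=> [sf hf cf] [sg hg cg]; have oT := @openT V.
split=> [|k l x|x]; first exact: csmoothM.
- have E j : cpartial j (fun y => f y * g y) =
      fun y => cpartial j f y * g y + f y * cpartial j g y.
    by apply/funext => y; exact: cpartialM sf sg I.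
  have sdf j := csmooth_cpartial j sf; have sdg j := csmooth_cpartial j sg.
  have E2 i j : cpartial i (fun y => cpartial j f y * g y + f y * cpartial j g y) x =
      cpartial i (cpartial j f) x * g x + cpartial j f x * cpartial i g x +
      (cpartial i f x * cpartial j g x + f x * cpartial i (cpartial j g) x).
    rewrite [LHS](cpartialD _ (csmoothM oT (sdf j) sg) (csmoothM oT sf (sdg j)) I).
    by rewrite (cpartialM _ (sdf j) sg I) (cpartialM _ sf (sdg j) I).
  rewrite !E !E2 hf hg.
  do ![match goal with |- context [cpartial ?i ?h x] =>
    generalize (cpartial i h x); intro end].
  by ring.
- exact: cauchy_riemannM sf sg I (cf x) (cg x).
Qed.

Lemma entireB f g : entire f -> entire g -> entire (fun x => f x - g x).
Proof.
move=> ef eg; have -> : (fun x => f x - g x) = (fun x => f x + (-1) * g x).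
  by apply/funext => x; rewrite mulN1r.
exact: (entireD ef (entireM (entire_cst (-1)) eg)).
Qed.

End Holomorphic.

Section FubiniStudyMatrix.
Variables (R : realType) (m : nat).
Local Notation C := R[i].
Local Notation V := 'rV[R]_(m + m).

Definition fubini_study_mx (J : finType) (v : J -> V -> C) (x : V) : 'M[R]_(m + m) :=
  \matrix_(k, l) complex.Im (fubini_study v x k l).

Section OneFamily.
Variables (J : finType) (v : J -> V -> C).
Hypothesis ev : forall j, entire (v j).
Hypothesis v0 : forall x, herm (v^~ x) (v^~ x) != 0.

Let sv j : csmooth setT (v j). Proof. by case: (ev j). Qed.

Lemma fubini_study_rshiftl x k l :
  fubini_study v x (rshift m k) l = 'i%C * fubini_study v x (lshift m k) l.
Proof.
rewrite /fubini_study -fs_formZl; congr (fs_form _ _ _).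
by apply/funext => j; have [_ _ ->] := ev j.
Qed.

Lemma fubini_study_rshiftr x k l :
  fubini_study v x k (rshift m l) = - 'i%C * fubini_study v x k (lshift m l).
Proof.
have -> : - 'i%C = ('i%C : C)^* by apply: complex_ext => /=; rewrite ?oppr0.
rewrite /fubini_study -fs_formZr; congr (fs_form _ _ _).
by apply/funext => j; have [_ _ ->] := ev j.
Qed.

Lemma fubini_study_mx_smooth : smooth_on setT (fubini_study_mx v).
Proof.
apply: smooth_on_mx => [|k l d]; first exact: openT.
apply: Ck_on_eq openT _ ((csmooth_fubini_study sv v0 k l).2 d) => x _.
by rewrite mxE.
Qed.

Lemma fubini_study_mx_anti x : (fubini_study_mx v x)^T = - fubini_study_mx v x.
Proof. by apply/matrixP => k l; rewrite !mxE -complex_Im_conj fs_form_conj. Qed.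

Lemma fubini_study_mx_closed : closed_form_on setT (fubini_study_mx v).
Proof.
move=> x _ k l d.
have E a b c : cpartial a (fun y => (fubini_study_mx v y b c)%:C%C) x =
    (2 * 'i%C)^-1 *
    cpartial a (fun y => fubini_study v y b c - fubini_study v y c b) x.
  have sB := csmoothB openT (csmooth_fubini_study sv v0 b c)
    (csmooth_fubini_study sv v0 c b).
  rewrite -(cpartialZ a _ openT sB I); congr (cpartial a _ x); apply/funext => y.
  have -> : fubini_study v y c b = (fubini_study v y b c)^* by rewrite fs_form_conj.
  rewrite mxE; move: (fubini_study v y b c) => z.
  have i0 : 2 * 'i%C != 0 :> C.
    by rewrite mulf_neq0 ?pnatr_eq0 // eq_complex /= oner_eq0 andbF.
  apply: (mulfI i0); rewrite mulVKf //.
  have -> : 2 = 2%:C%C :> C by rewrite rmorph_nat.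
  apply: complex_ext; rewrite ?(complex_ReM, complex_ImM, complex_ReD, complex_ImD);
    rewrite ?(complex_ReN, complex_ImN, complex_Re_conj, complex_Im_conj) /=; ring.
rewrite !E -!mulrDr.
have hv j : symmetric_hessian (v j) by case: (ev j).
exact: etrans (congr1 _ (fubini_study_closed sv v0 hv k l d x)) (mulr0 _).
Qed.

Lemma fubini_study_mx_complex x :
  fubini_study_mx v x *m complex_mx R m = complex_mx R m *m fubini_study_mx v x.
Proof.
pose h := fubini_study v x.
rewrite -[fubini_study_mx v x]submxK.
set a := ulsubmx _; set b := ursubmx _; set c := dlsubmx _; set d := drsubmx _.
have cb : c = - b.
  apply/matrixP => k l; rewrite !mxE fubini_study_rshiftl fubini_study_rshiftr.
  by rewrite !complex_ImM /=; ring.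
have da : d = a.
  apply/matrixP => k l; rewrite !mxE fubini_study_rshiftl fubini_study_rshiftr.
  by rewrite mulrA mulrN mulCi opprK mul1r.
rewrite cb da !mulmx_block !mulmx0 !mul0mx !addr0 !add0r.
by rewrite !mulmxN !mulNmx !mulmx1 !mul1mx.
Qed.

Lemma fubini_study_mx_trans (v' : J -> V -> C) (U : set V) (phi : V -> V)
    (g : V -> C) x : (forall j, entire (v' j)) -> open U -> U x -> smooth_on U phi ->
  csmooth U g -> g x != 0 ->
  (forall y, U y -> forall j, v' j (phi y) = g y * v j y) ->
  fubini_study_mx v x =
  jacobian phi x *m fubini_study_mx v' (phi x) *m (jacobian phi x)^T.
Proof.
move=> ev' oU Ux sphi sg gx vE; set D := jacobian phi x.
pose D' a b : C := (D a b)%:C%C.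
have svU j : csmooth U (v j).
  by have [s1 s2] := sv j; split; [exact: smooth_onS s1|exact: smooth_onS s2].
have dE k : (fun j => \sum_a D' k a * cpartial a (v' j) (phi x)) =
    (fun j => g x * cpartial k (v j) x + cpartial k g x * v j x).
  apply/funext => j; have [sv' _ _] := ev' j.
  rewrite -[LHS](cpartial_comp k oU Ux sphi sv') addrC -(cpartialM k sg (svU j) Ux).
  by apply: eq_cpartial oU _ Ux => y Uy; exact: vE.
have vxE : (fun j => v' j (phi x)) = (fun j => g x * v j x).
  by apply/funext => j; exact: vE.
have FE k l : fubini_study v x k l =
    \sum_a D' k a * \sum_b D' l b * fubini_study v' (phi x) a b.
  rewrite /fubini_study vxE.
  rewrite -(fs_form_rescale (cpartial k g x) (cpartial l g x) _ _ gx (v0 x)).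
  rewrite -[X in fs_form _ X _]dE -[X in fs_form _ _ X]dE fs_form_suml.
  apply: eq_bigr => a _; rewrite fs_form_sumr.
  by congr (_ * _); apply: eq_bigr => b _; rewrite [(D' l b)^*]conjc_real.
apply/matrixP => k l; rewrite mxE FE complex_Im_sum -mulmxA [RHS]mxE.
apply: eq_bigr => a _; rewrite complex_ImM /= mul0r addr0 complex_Im_sum.
rewrite [X in _ = _ * X]mxE; congr (_ * _); apply: eq_bigr => b _.
by rewrite complex_ImM /= mul0r addr0 [D^T _ _]mxE mulrC [fubini_study_mx _ _ _ _]mxE.
Qed.

Definition directional (X : V) (x : V) (j : J) : C :=
  \sum_k (X 0 k)%:C%C * cpartial k (v j) x.

Lemma fubini_study_directional (X x : V) :
  \sum_l (X 0 l)%:C%C * \sum_k (X 0 k)%:C%C * fubini_study v x k l =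
  fs_form (v^~ x) (directional X x) (directional X x).
Proof.
rewrite fs_form_sumr; apply: eq_bigr => l _.
by rewrite fs_form_suml [(_)^*]conjc_real.
Qed.

End OneFamily.

Lemma fubini_study_mx_nondegenerate (J J' : finType) (v : J -> V -> C)
    (w : J' -> V -> C) (x X : V) :
  (forall j, entire (v j)) -> (forall j, entire (w j)) ->
  herm (v^~ x) (v^~ x) != 0 -> herm (w^~ x) (w^~ x) != 0 ->
  X *m (fubini_study_mx v x + fubini_study_mx w x) = 0 ->
  (forall i j, v i x * directional v X x j = v j x * directional v X x i) /\
  (forall i j, w i x * directional w X x j = w j x * directional w X x i).
Proof.
move=> ev ew v0 w0 XW.
pose h k l := fubini_study v x k l + fubini_study w x k l.
have hr k l : h k (rshift m l) = - 'i%C * h k (lshift m l).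
  by rewrite /h !fubini_study_rshiftr // -mulrDr.
have ImX l : complex.Im (\sum_k (X 0 k)%:C%C * h k l) = 0.
  have /rowP/(_ l) := XW; rewrite !mxE => E.
  rewrite -[RHS]E complex_Im_sum; apply: eq_bigr => k _.
  by rewrite complex_ImM /= mul0r addr0 !mxE complex_ImD.
have Xr l : \sum_k (X 0 k)%:C%C * h k (rshift m l) =
    - 'i%C * \sum_k (X 0 k)%:C%C * h k (lshift m l).
  by rewrite mulr_sumr; apply: eq_bigr => k _; rewrite hr mulrCA.
have Xl l : \sum_k (X 0 k)%:C%C * h k (lshift m l) = 0.
  apply: complex_ext; last exact: ImX.
  have ImNi (z : C) : complex.Im (- 'i%C * z) = - complex.Re z.
    by case: z => a b /=; ring.
  apply: oppr_inj; rewrite [RHS]oppr0 -[LHS]ImNi.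
  exact: etrans (congr1 _ (esym (Xr l))) (ImX (rshift m l)).
have X0 l : \sum_k (X 0 k)%:C%C * h k l = 0.
  have [a ->|a ->] := split_ordP l; first exact: Xl.
  exact: etrans (Xr a) (etrans (congr1 _ (Xl a)) (mulr0 _)).
have : fs_form (v^~ x) (directional v X x) (directional v X x) +
    fs_form (w^~ x) (directional w X x) (directional w X x) = 0.
  rewrite -!fubini_study_directional -big_split big1 //= => l _.
  rewrite -mulrDr -big_split /= -[RHS](mulr0 (X 0 l)%:C%C) -[in RHS](X0 l).
  by congr (_ * _); apply: eq_bigr => k _; rewrite -mulrDr.
move=> /eqP; rewrite (paddr_eq0 (fs_form_ge0 _ v0) (fs_form_ge0 _ w0)).
move=> /andP[/eqP E1 /eqP E2].
by split; [exact: fs_form_eq0 v0 E1|exact: fs_form_eq0 w0 E2].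
Qed.

End FubiniStudyMatrix.

(** * The flag manifold *)

Section FlagKahler.
Variable R : realType.
Local Notation C := R[i].
Local Notation V := 'rV[R]_(3 + 3).
Implicit Types (s t : 'S_3) (x y X : V).

Lemma derive_coord (v x : V) j : 'D_v (fun y : V => y 0 j) x = v 0 j.
Proof.
by rewrite -[v in RHS](derive_id x v) derive_mx ?mxE //; exact: derivable_id.
Qed.

Lemma cpartial_zcoord k (j : 'I_3) x : cpartial k (fun y : V => zcoord y j) x =
  Complex ((delta_mx 0 k : V) 0 (lshift 3 j)) ((delta_mx 0 k : V) 0 (rshift 3 j)).
Proof.
congr (Complex _ _); rewrite -[RHS](derive_coord _ x);
  by apply: eq_derive => y /=; rewrite mxE.
Qed.

Lemma entire_zcoord (j : 'I_3) : entire (fun x : V => zcoord x j).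
Proof.
split=> [|k l x|x k]; first exact: csmooth_zcoord.
  have E i : cpartial i (fun y : V => zcoord y j) = fun=>
      Complex ((delta_mx 0 i : V) 0 (lshift 3 j)) ((delta_mx 0 i : V) 0 (rshift 3 j)).
    by apply/funext => y; exact: cpartial_zcoord.
  by rewrite !E !cpartial_cst.
rewrite !cpartial_zcoord !mxE !eqxx /=.
rewrite !(inj_eq (@lshift_inj _ _), inj_eq (@rshift_inj _ _)).
rewrite eq_lrshift eq_rlshift.
by apply: complex_ext; rewrite ?(complex_ReM, complex_ImM) /=; ring.
Qed.

Lemma zcoord_directional X x (j : 'I_3) :
  \sum_k (X 0 k)%:C%C * cpartial k (fun y : V => zcoord y j) x = zcoord X j.
Proof.
under eq_bigr do rewrite cpartial_zcoord.
rewrite zcoord_def !mxE; apply: complex_ext.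
  rewrite complex_Re_sum (bigD1 (lshift 3 j)) //= big1 ?addr0 => [|k /negbTE kj].
    by rewrite mul0r subr0 !mxE !eqxx mulr1.
  by rewrite mul0r subr0 !mxE eq_sym kj andbF mulr0.
rewrite complex_Im_sum (bigD1 (rshift 3 j)) //= big1 ?addr0 => [|k /negbTE kj].
  by rewrite mul0r addr0 !mxE !eqxx mulr1.
by rewrite mul0r addr0 !mxE eq_sym kj andbF mulr0.
Qed.

Definition line_vec s (j : 'I_3) x : C := flag_vec1 s x 0 j.

(* The Pluecker coordinates of the plane of the flag. *)
Definition plane_vec s (p : 'I_3 * 'I_3) x : C :=
  flag_vec1 s x 0 p.1 * flag_vec2 s x 0 p.2 - flag_vec2 s x 0 p.1 * flag_vec1 s x 0 p.2.

Lemma entire_line_vec s j : entire (line_vec s j).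
Proof.
have -> : line_vec s j = fun x => flag_basis R s 0 0 j +
    zcoord x 0 * flag_basis R s 1 0 j + zcoord x 1 * flag_basis R s 2 0 j.
  by apply/funext => x; exact: flag_vec1_coord.
pose cst c : entire (fun _ : V => c) := entire_cst 3 c.
exact: (entireD (entireD (cst (flag_basis R s 0 0 j))
  (entireM (entire_zcoord 0) (cst (flag_basis R s 1 0 j))))
  (entireM (entire_zcoord 1) (cst (flag_basis R s 2 0 j)))).
Qed.

Lemma entire_flag_vec2 s j : entire (fun x => flag_vec2 s x 0 j).
Proof.
have -> : (fun x => flag_vec2 s x 0 j) = fun x => flag_basis R s 1 0 j +
    zcoord x 2 * flag_basis R s 2 0 j.
  by apply/funext => x; exact: flag_vec2_coord.
exact: (entireD (entire_cst 3 (flag_basis R s 1 0 j))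
  (entireM (entire_zcoord 2) (entire_cst 3 (flag_basis R s 2 0 j)))).
Qed.

Lemma entire_plane_vec s p : entire (plane_vec s p).
Proof.
exact: (entireB (entireM (entire_line_vec s p.1) (entire_flag_vec2 s p.2))
  (entireM (entire_flag_vec2 s p.1) (entire_line_vec s p.2))).
Qed.

Lemma line_vecE s x : [/\ line_vec s (s 0) x = 1,
  line_vec s (s 1) x = zcoord x 0 & line_vec s (s 2) x = zcoord x 1].
Proof. exact: flag_vec1E. Qed.

Lemma plane_vecE s x :
  plane_vec s (s 0, s 1) x = 1 /\ plane_vec s (s 0, s 2) x = zcoord x 2.
Proof.
move: (flag_vec1E s x) (flag_vec2E s x); rewrite /plane_vec /=.
move: (flag_vec1 s x) (flag_vec2 s x) (zcoord x 2) => v w z.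
by move=> [-> -> ->] [-> -> ->]; rewrite !mul1r !mul0r !subr0.
Qed.

Lemma herm_line_vec s x : herm (line_vec s ^~ x) (line_vec s ^~ x) != 0.
Proof.
by apply: (@herm_neq0 _ _ _ (s 0)); have [-> _ _] := line_vecE s x; exact: oner_neq0.
Qed.

Lemma herm_plane_vec s x : herm (plane_vec s ^~ x) (plane_vec s ^~ x) != 0.
Proof.
by apply: (@herm_neq0 _ _ _ (s 0, s 1)); have [-> _] := plane_vecE s x; exact: oner_neq0.
Qed.

Definition flag_kahler_mx s x : 'M[R]_(3 + 3) :=
  fubini_study_mx (line_vec s) x + fubini_study_mx (plane_vec s) x.

Lemma directional_cst (J : finType) (v : J -> V -> C) X x i (c : C) :
  (forall y, v i y = c) -> directional v X x i = 0.
Proof.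
move=> vi; apply: big1 => k _; rewrite (_ : v i = fun=> c); last exact/funext.
by rewrite cpartial_cst mulr0.
Qed.

Lemma directional_zcoord (J : finType) (v : J -> V -> C) X x i (j : 'I_3) :
  (forall y, v i y = zcoord y j) -> directional v X x i = zcoord X j.
Proof.
move=> vi; rewrite -(zcoord_directional X x); apply: eq_bigr => k _.
by rewrite (_ : v i = fun y => zcoord y j) //; apply/funext.
Qed.

Lemma flag_kahler_mx_unit s x : flag_kahler_mx s x \in unitmx.
Proof.
rewrite -row_free_unit -kermx_eq0; apply/eqP/row_matrixP => i.
rewrite row0; set X := row i _.
have XW : X *m flag_kahler_mx s x = 0 by rewrite -row_mul mulmx_ker row0.
have [E1 E2] := fubini_study_mx_nondegenerate (entire_line_vec s)
  (entire_plane_vec s) (herm_line_vec s x) (herm_plane_vec s x) XW.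
have l0 y : line_vec s (s 0) y = 1 by case: (line_vecE s y).
have l1 y : line_vec s (s 1) y = zcoord y 0 by case: (line_vecE s y).
have l2 y : line_vec s (s 2) y = zcoord y 1 by case: (line_vecE s y).
have p1 y : plane_vec s (s 0, s 1) y = 1 by case: (plane_vecE s y).
have p2 y : plane_vec s (s 0, s 2) y = zcoord y 2 by case: (plane_vecE s y).
have zX : forall j, zcoord X j = 0.
  apply: ord3P.
  - have := E1 (s 0) (s 1); rewrite l0 mul1r (directional_cst _ _ l0) mulr0.
    by rewrite (directional_zcoord _ _ l1).
  - have := E1 (s 0) (s 2); rewrite l0 mul1r (directional_cst _ _ l0) mulr0.
    by rewrite (directional_zcoord _ _ l2).
  - have := E2 (s 0, s 1) (s 0, s 2); rewrite p1 mul1r (directional_cst _ _ p1) mulr0.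
    by rewrite (directional_zcoord _ _ p2).
apply: zcoord_inj => j; rewrite zX zcoord_def !mxE.
by [].
Qed.

Lemma flag_kahler_mx_smooth s : smooth_on setT (flag_kahler_mx s).
Proof.
move=> k; apply: (Ck_onD openT).
  exact: (fubini_study_mx_smooth (entire_line_vec s) (herm_line_vec s)).
exact: (fubini_study_mx_smooth (entire_plane_vec s) (herm_plane_vec s)).
Qed.

Lemma flag_kahler_mx_anti s x : (flag_kahler_mx s x)^T = - flag_kahler_mx s x.
Proof. by rewrite linearD /= !fubini_study_mx_anti opprD. Qed.

Lemma flag_kahler_mx_closed s : closed_form_on setT (flag_kahler_mx s).
Proof.
apply: closed_form_onD => [||||]; first exact: openT.
- exact: (fubini_study_mx_smooth (entire_line_vec s) (herm_line_vec s)).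
- exact: (fubini_study_mx_smooth (entire_plane_vec s) (herm_plane_vec s)).
- exact: (fubini_study_mx_closed (entire_line_vec s) (herm_line_vec s)).
- exact: (fubini_study_mx_closed (entire_plane_vec s) (herm_plane_vec s)).
Qed.

Lemma flag_kahler_mx_complex s x :
  flag_kahler_mx s x *m complex_mx R 3 = complex_mx R 3 *m flag_kahler_mx s x.
Proof.
rewrite mulmxDl mulmxDr (fubini_study_mx_complex (entire_line_vec s)).
by rewrite (fubini_study_mx_complex (entire_plane_vec s)).
Qed.

Section Transition.
Variables s t : 'S_3.

Local Notation U :=
  (overlap (@dom R _ (flag_manifold R)) (@par R _ (flag_manifold R)) s t).
Local Notation phi :=
  (transition (@dom R _ (flag_manifold R)) (@par R _ (flag_manifold R)) s t).

Lemma flag_trans_zcoord y k : U y -> zcoord (phi y) k = new_coord s t y k.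
Proof. by move=> Uy; rewrite [phi y]flag_transitionE // of_zcoordK. Qed.

Lemma flag_overlap_neq0 y : U y -> flag_vec1 s y 0 (t 0) != 0 /\ minor s t y != 0.
Proof. by move=> Uy; have : overlap _ _ _ _ _ := Uy; rewrite flag_overlapE. Qed.

Lemma line_vec_trans y j : U y ->
  line_vec t j (phi y) = (flag_vec1 s y 0 (t 0))^-1 * line_vec s j y.
Proof.
move=> Uy; have [a0 m0] := flag_overlap_neq0 Uy.
rewrite -(permKV t j); move: (_ j); apply: ord3P; have [e0 e1 e2] := line_vecE t (phi y).
- by rewrite e0 mulVf.
- by rewrite e1 flag_trans_zcoord // mulrC.
- by rewrite e2 flag_trans_zcoord // mulrC.
Qed.

Lemma plane_vec_trans y p : U y ->
  plane_vec t p (phi y) = (minor s t y)^-1 * plane_vec s p y.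
Proof.
move=> Uy; have [a0 m0] := flag_overlap_neq0 Uy.
have [z0 z1 z2] := And3 (flag_trans_zcoord 0 Uy) (flag_trans_zcoord 1 Uy)
  (flag_trans_zcoord 2 Uy).
have [e0 e1 e2] := flag_vec1E t (phi y); have [f0 f1 f2] := flag_vec2E t (phi y).
case: p => i j; rewrite -(permKV t i) -(permKV t j) /plane_vec /=.
move: e0 e1 e2 f0 f1 f2 z0 z1 z2 m0; rewrite /new_coord /minor /=.
move: (flag_vec1 t _) (flag_vec2 t _) (zcoord _ 0) (zcoord _ 1) (zcoord _ 2) a0.
move: (flag_vec1 s y) (flag_vec2 s y) => a b v w x0 x1 x2 a0 e0 e1 e2 f0 f1 f2 z0 z1 z2.
move: e0 e1 e2 f0 f1 f2; rewrite {}z0 {}z1 {}z2.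
move=> e0 e1 e2 f0 f1 f2 m0.
move: (_ i) (_ j); apply: ord3P; apply: ord3P; rewrite ?(e0, e1, e2, f0, f1, f2);
  by field; rewrite ?a0 ?m0.
Qed.

Lemma flag_kahler_mx_trans x : U x -> flag_kahler_mx s x =
  jacobian phi x *m flag_kahler_mx t (phi x) *m (jacobian phi x)^T.
Proof.
move=> Ux; have oU : open U by exact: flag_overlap_open.
have [a0 m0] := flag_overlap_neq0 Ux.
have sphi : smooth_on U phi by exact: flag_transition_smooth.
have sa := csmoothV oU (fun y Uy => (flag_overlap_neq0 Uy).1)
  (csmooth_vec1 s (t 0) oU).
have sm := csmoothV oU (fun y Uy => (flag_overlap_neq0 Uy).2) (csmooth_minor s t oU).
have a0' := invr_neq0 a0; have m0' := invr_neq0 m0.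
rewrite /flag_kahler_mx mulmxDr mulmxDl; congr (_ + _).
  exact: (fubini_study_mx_trans (entire_line_vec s) (herm_line_vec s)
    (entire_line_vec t) oU Ux sphi sa a0' (fun y Uy j => line_vec_trans j Uy)).
exact: (fubini_study_mx_trans (entire_plane_vec s) (herm_plane_vec s)
  (entire_plane_vec t) oU Ux sphi sm m0' (fun y Uy p => plane_vec_trans p Uy)).
Qed.

Lemma cauchy_riemann_new_coord x : U x ->
  forall k, cauchy_riemann (fun y => new_coord s t y k) x.
Proof.
move=> Ux; have oU : open U by exact: flag_overlap_open.
have sa j : csmooth U (fun y => flag_vec1 s y 0 j) by exact: csmooth_vec1.
have sb j : csmooth U (fun y => flag_vec2 s y 0 j) by exact: csmooth_vec2.
have ca j : cauchy_riemann (fun y => flag_vec1 s y 0 j) x.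
  by case: (entire_line_vec s j).
have sdiv f g : (forall y, U y -> g y != 0) -> csmooth U f -> csmooth U g ->
    cauchy_riemann f x -> cauchy_riemann g x ->
    cauchy_riemann (fun y => f y / g y) x.
  move=> g0 sf sg cf cg.
  exact: cauchy_riemannM sf (csmoothV oU g0 sg) Ux cf (cauchy_riemannV oU g0 sg Ux cg).
have a0 y (Uy : U y) := (flag_overlap_neq0 Uy).1.
have m0 y (Uy : U y) := (flag_overlap_neq0 Uy).2.
apply: ord3P.
- exact: sdiv a0 (sa _) (sa _) (ca _) (ca _).
- exact: sdiv a0 (sa _) (sa _) (ca _) (ca _).
- have sn := csmoothB oU (csmoothM oU (sa (t 0)) (sb (t 2)))
    (csmoothM oU (sb (t 0)) (sa (t 2))).
  apply: sdiv m0 sn (csmooth_minor s t oU) _ _.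
    by case: (entire_plane_vec s (t 0, t 2)).
  by have [_ _ cm] := entire_plane_vec s (t 0, t 1); exact: cm.
Qed.

Lemma jacobian_flag_trans x : U x ->
  complex_mx R 3 *m jacobian phi x = jacobian phi x *m complex_mx R 3.
Proof.
move=> Ux; have oU : open U by exact: flag_overlap_open.
have sphi : smooth_on U phi by exact: flag_transition_smooth.
have dphi := (sphi 1%N).1 x Ux.
set D := jacobian phi x.
have DE k l : D k l = 'D_(delta_mx 0 k) (fun y => phi y 0 l) x.
  have -> : D k l = row k D 0 l by rewrite [RHS]mxE.
  by rewrite rowE -deriveEjacobian // derive_mx ?mxE //; exact: diff_derivable.
have cphi k a : cpartial k (fun y => new_coord s t y a) x =
    Complex (D k (lshift 3 a)) (D k (rshift 3 a)).
  rewrite -(eq_cpartial k oU (fun y Uy => flag_trans_zcoord a Uy) Ux) !DE.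
  by congr (Complex _ _); apply: eq_derive => y /=; rewrite mxE.
have CR k a : D (rshift 3 k) (lshift 3 a) = - D (lshift 3 k) (rshift 3 a) /\
    D (rshift 3 k) (rshift 3 a) = D (lshift 3 k) (lshift 3 a).
  have := cauchy_riemann_new_coord Ux a k; rewrite !cphi => E.
  split; [have /= -> := congr1 (@complex.Re R) E|have /= -> := congr1 (@complex.Im R) E];
    by ring.
clearbody D; rewrite -[D]submxK.
have -> : dlsubmx D = - ursubmx D.
  by apply/matrixP => k a; rewrite !mxE; case: (CR k a).
have -> : drsubmx D = ulsubmx D.
  by apply/matrixP => k a; rewrite !mxE; case: (CR k a).
rewrite !mulmx_block !mulmx0 !mul0mx !addr0 !add0r.
by rewrite !mulmxN !mulNmx !mulmx1 !mul1mx.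
Qed.

End Transition.
End FlagKahler.

Theorem proposition7 (R : realType) :
  exists I1 I2 : tt_endo (flag_manifold R), generalized_pseudo_kahler I1 I2.
Proof.
do 2![eexists].
apply: (@generalized_pseudo_kahler_of_pseudo_kahler R 3 (flag_manifold R)
  (@flag_kahler_mx R)) => [s t x Ux|s|s x _|s x _|s|s x _|s t x Ux].
- exact: jacobian_flag_trans.
- exact: flag_kahler_mx_smooth.
- exact: flag_kahler_mx_anti.
- exact: flag_kahler_mx_unit.
- exact: flag_kahler_mx_closed.
- exact: flag_kahler_mx_complex.
- exact: flag_kahler_mx_trans.
Qed.
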